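(* Let $\Delta$ be a finite simplicial complex with $\operatorname{depth}\Delta=d-1$, and let $r$ be an integer with $2\le r\le d/2$. Let $\mathcal{A},\mathcal{B}$ be nonempty cross-intersecting Sperner families consisting of faces of $\Delta$, each face having at most $r$ vertices. If $\Delta$ is shifted with respect to $\{v_1<\cdots<v_r\}$, then \[|\mathcal{A}|+|\mathcal{B}|\le f_r(\Delta)-\gamma+1,\] where $\gamma$ is the number of $r$-element faces of $\Delta$ containing no element of $\{v_1,\dots,v_r\}$.
   Context: A simplicial complex is a nonempty finite family of sets closed under subsets; $f_k(\Delta)$ is the number of $k$-element faces; $\operatorname{link}_\Delta A=\{B\in\Delta:A\cap B=\emptyset,A\cup B\in\Delta\}$. Fix a field $\mathbb{F}$. A complex $\Gamma$ is Cohen-Macaulay if $\tilde H_i(\operatorname{link}_\Gamma A;\mathbb{F})=0$ for all faces $A$ (including $\emptyset$) and all $i<\dim\operatorname{link}_\Gamma A$ (a face $A$ has dimension $|A|-1$). The depth of $\Delta$ is the largest $k$ such that the subcomplex of faces of dimension at most $k$ is Cohen-Macaulay. $\Delta$ is shifted with respect to $\{v_1<\cdots<v_t\}$ if for every $i\le t$, every face $B$, and every $w\in B$ with $w\notin\{v_1,\dots,v_i\}$ and $v_i\notin B$, the set $(B\setminus\{w\})\cup\{v_i\}$ is a face. A Sperner family is a family of sets with no member properly contained in another. $\mathcal{A},\mathcal{B}$ are cross-intersecting if $A\cap B\ne\emptyset$ for all $A\in\mathcal{A},B\in\mathcal{B}$. *)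

(* Defs.v *)
From HB Require Import structures.
From mathcomp Require Import all_boot all_order all_algebra.
Set Implicit Arguments. Unset Strict Implicit. Unset Printing Implicit Defensive.
Import GRing.Theory.
Local Open Scope ring_scope.

Section Defs.
Variable T : finType.

Definition simplicial_complex (D : {set {set T}}) : Prop :=
  D != set0 /\ forall A B : {set T}, A \in D -> B \subset A -> B \in D.

Definition fnum (D : {set {set T}}) (k : nat) : nat := #|[set A in D | (#|A| == k)%N]|.

Definition link (D : {set {set T}}) (A : {set T}) : {set {set T}} :=
  [set B in D | [disjoint A & B] && (A :|: B \in D)].

(* maximal number of vertices of a face (= dimension + 1) *)
Definition maxsize (D : {set {set T}}) : nat := \max_(B in D) #|B|.

(* k-skeleton indexed by size: faces with at most m vertices
   (i.e. of dimension at most m-1) *)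
Definition skel (D : {set {set T}}) (m : nat) : {set {set T}} :=
  [set A in D | (#|A| <= m)%N].

Variable F : fieldType.

(* simplicial chains: F-valued functions on sets; the oriented face
   is oriented by the increasing order of enum_rank *)
Definition bd (c : {ffun {set T} -> F}) : {ffun {set T} -> F} :=
  [ffun B : {set T} => \sum_(x in ~: B)
      (-1) ^+ #|[set y in B | enum_rank y < enum_rank x]%N| * c (x |: B)].

Definition supported (D : {set {set T}}) (k : nat) (c : {ffun {set T} -> F}) : Prop :=
  forall B, c B != 0 -> B \in D /\ #|B| = k.

(* reduced homology H~_{k-1}(D;F) vanishes (chains on k-element faces) *)
Definition rhom_vanish (D : {set {set T}}) (k : nat) : Prop :=
  forall c, supported D k c -> bd c = 0 ->
    exists d, supported D k.+1 d /\ bd d = c.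

(* Cohen-Macaulay over F: H~_i(link A) = 0 for all i < dim link A,
   i.e. for all k = i+1 < maxsize (link A) (and i = -1 included as k = 0). *)
Definition cohen_macaulay (G : {set {set T}}) : Prop :=
  forall A, A \in G -> forall k, (k < maxsize (link G A))%N ->
    rhom_vanish (link G A) k.

(* depth D = m - 1, with the convention that the depth is at most dim D:
   the (m-1)-skeleton is CM and no larger skeleton up to dim D is CM. *)
Definition depth_is (D : {set {set T}}) (m : nat) : Prop :=
  [/\ (m <= maxsize D)%N, cohen_macaulay (skel D m) &
      forall e, (m < e <= maxsize D)%N -> ~ cohen_macaulay (skel D e)].

End Defs.

Section Defs2.
Variable T : finType.

Definition shifted_wrt (D : {set {set T}}) (v : seq T) : Prop :=
  forall i, (i < size v)%N -> forall (B : {set T}) (w : T),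
    B \in D -> w \in B -> w \notin take i.+1 v -> nth w v i \notin B ->
    (nth w v i |: (B :\ w)) \in D.

Definition sperner (S : {set {set T}}) : Prop :=
  forall A B, A \in S -> B \in S -> A \subset B -> A = B.

Definition cross_intersecting (S1 S2 : {set {set T}}) : Prop :=
  forall A B, A \in S1 -> B \in S2 -> A :&: B != set0.
End Defs2.

(* Main.v *)
Require Import Defs.
From HB Require Import structures.
From mathcomp Require Import all_boot all_order all_algebra.
From mathcomp Require Import zify ring.
Set Implicit Arguments. Unset Strict Implicit. Unset Printing Implicit Defensive.
Import GRing.Theory.

(* The exterior algebra replaces faces by monomials: to a family S of r-faces corresponds the
   subspace spanned by its monomials, and "cross-intersecting" says that the products of the
   two subspaces vanish. Both properties, and the dimensions, survive a linear change of
   the generators, and passing to leading monomials for a lexicographic order (with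
   V = {v_1, ..., v_r} first) gives cross-intersecting families again. Over an infinite
   extension of F, elementary changes of generators that increase the leading monomials are
   performed until none is possible; the two families of leading monomials are then shifted.

   Purity of the Cohen-Macaulay (d-1)-skeleton and shiftedness show that, up to size r, the
   complex is the join of the simplex V with L = link V, which is Cohen-Macaulay of size
   d - r >= r. For functionals l_1, ..., l_m independent on the faces of L, a chain of size b
   killed by all l_i has the form l_1 ... l_m w as long as b + m <= d - r (a Koszul exactness
   statement proved over K[y_1, ..., y_m] from the vanishing of the homology of links). Hence a
   leading monomial B of the complex avoiding the first k elements can be enlarged by these k
   elements whenever the sizes permit.

   For shifted families, A in the first one implies that no set B of the second one satisfies
   |A n [k]| + |B n [k]| <= k for all k. The reflection of A at the last k with
   2 |A n [k]| = k is such a B, and it stays in the complex by the enlargement property. So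
   the reflection maps the second family, without V, into the r-faces meeting V, other than V,
   that are not in the first family; counting gives the bound. *)

(** The members of the two families may have different sizes. A face A with fewer than r vertices
    lies in more than |A| faces with one more vertex, so both families can be raised to uniform size
    r without losing cardinality, each new set containing an old one. The shifting is done linearly
    because a combinatorial exchange outside V may leave the complex, which is only known to admit
    exchanges towards V. The price is that the leading monomials are compared with those of the
    whole complex, and that closure of the latter under reflection has to be won from homology:
    hence the vanishing for links in L, and generators that are generic for L. The inequality 2r <=
    d enters three times: in the raising step, in the final height n - 2r >= 0 of the walks, and as
    r <= d - r, which bounds the sizes where exactness is used. *)

(** * Raising Sperner families to uniform size *)

Section Push.
Variables (T : finType) (D : {set {set T}}) (r : nat).
Implicit Types (A B : {set T}) (S : {set {set T}}).
Definition upper_shadow A := [set B : {set T} in D | (#|B| == #|A|.+1) && (A \subset B)].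
Hypothesis up_ge : forall A, A \in D -> #|A| < r -> #|A| < #|upper_shadow A|.

(** Pairs of a set and a cover of it are counted twice: A has at least k + 1 covers by [up_ge], and
    B has k + 1 subsets of size k. *)
Lemma shadow_card S k : S \subset D -> k < r -> (forall A, A \in S -> #|A| = k) ->
  #|S| <= #|\bigcup_(A in S) upper_shadow A|.
Proof.
move=> SD kr hk; set N := \bigcup_(A in S) upper_shadow A.
rewrite -(leq_pmul2r (ltn0Sn k)).
have le1 : #|S| * k.+1 <= \sum_(A in S) \sum_(B in N) (A \subset B).
  rewrite -sum_nat_const; apply: leq_sum => A AS.
  have := up_ge (subsetP SD _ AS); rewrite hk // => /(_ kr) h; apply: leq_trans h _.
  rewrite -sum1_card [X in _ <= X](bigID (fun B => A \subset B)) /=; apply: leq_trans (leq_addr _ _).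
  rewrite [X in _ <= X](eq_bigr (fun=> 1)); last by move=> B /andP[_ ->].
  rewrite !sum1_card; apply: subset_leq_card; apply/subsetP => B hB; rewrite unfold_in /=.
  apply/andP; split; last by move: hB; rewrite inE => /and3P[].
  by apply/bigcupP; exists A.
apply: leq_trans le1 _; rewrite exchange_big -sum_nat_const; apply: leq_sum => B BN.
have cB : #|B| = k.+1.
  by case/bigcupP: BN => A AS; rewrite inE (hk A AS) => /and3P[_ /eqP].
rewrite -big_mkcondr sum1_card -[X in _ <= X]binSn -cB -cards_draws.
apply: subset_leq_card; apply/subsetP => A; rewrite !inE => /andP[AS ->].
by rewrite (hk A AS) eqxx.
Qed.

(** The members of the lowest admissible size are replaced by their upper shadow, one level at a
    time. The Sperner property keeps the shadow disjoint from the other members and the new family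
    Sperner. The last clause carries the cross-intersecting property over to the raised families. *)
Lemma sperner_push S : S \subset D -> sperner S -> (forall A, A \in S -> #|A| <= r) ->
  exists S', [/\ S' \subset D, forall A, A \in S' -> #|A| = r, #|S| <= #|S'| &
    forall B, B \in S' -> exists2 A, A \in S & A \subset B].
Proof.
suff H m : forall S, S \subset D -> sperner S ->
    (forall A, A \in S -> r - m <= #|A| <= r) ->
  exists S', [/\ S' \subset D, forall A, A \in S' -> #|A| = r, #|S| <= #|S'| &
    forall B, B \in S' -> exists2 A, A \in S & A \subset B].
  move=> SD sS hS; apply: (H r) => // A AS; rewrite subnn; exact: hS.
elim: m => [|m IH] {}S SD sS hS.
  exists S; split=> // [A /hS|B BS]; first by rewrite subn0 -eqn_leq => /eqP.
  by exists B.
(* Truncated subtraction: both lower bounds are 0 here. *)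
case: (leqP r m) => rm.
  by apply: IH => // A /hS; have -> : r - m.+1 = r - m by lia.
set k := r - m.+1; have kr : k < r by rewrite /k; lia.
have kS : r - m = k.+1 by rewrite /k; lia.
pose Sk := [set A in S | #|A| == k].
pose N := \bigcup_(A in Sk) upper_shadow A.
have SkS : Sk \subset S by apply/subsetP => A; rewrite inE => /andP[].
have leN : #|Sk| <= #|N|.
  apply: (shadow_card (k := k)) => //; first exact: subset_trans SD.
  by move=> A; rewrite inE => /andP[_ /eqP].
have NP B : B \in N -> exists A, [/\ A \in S, #|A| = k, #|B| = k.+1, A \subset B & B \in D].
  case/bigcupP => A; rewrite inE => /andP[AS /eqP cA]; rewrite inE cA => /and3P[BD /eqP cB sAB].
  by exists A.
have S1P A : A \in S :\: Sk -> A \in S /\ k < #|A|.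
  rewrite !inE => /andP[h AS]; split=> //; have /andP[] := hS A AS; rewrite leq_eqVlt.
  by move: h; rewrite AS /= eq_sym => /negbTE ->.
have noNS B A : B \in N -> A \in S -> B \subset A -> False.
  move=> /NP[A0 [A0S c0 cB sB _]] AS sBA.
  have e := sS A0 A A0S AS (subset_trans sB sBA).
  by have := subset_leq_card sBA; rewrite cB -e c0 ltnn.
have dN : [disjoint S :\: Sk & N].
  rewrite -setI_eq0; apply/eqP/setP => A; rewrite inE [RHS]inE; apply/negP => /andP[/S1P[AS _] AN].
  exact: (noNS A A).
have [||A|S' [S'D cS' leS' hS']] := IH ((S :\: Sk) :|: N).
- rewrite subUset (subset_trans (subsetDl _ _) SD); apply/subsetP => B /NP[A [_ _ _ _]].
  done.
- move=> A B /setUP[/S1P[AS cA]|AN] /setUP[/S1P[BS cB]|BN] sAB.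
  + exact: sS.
  + have [A0 [_ _ cB _ _]] := NP B BN; apply/eqP; rewrite eqEcard sAB cB //.
  + by have := noNS A B AN BS sAB.
  + have [_ [_ _ cA _ _]] := NP A AN; have [_ [_ _ cB _ _]] := NP B BN.
    by apply/eqP; rewrite eqEcard sAB cA cB leqnn.
- rewrite kS => /setUP[/S1P[AS ->]|/NP[_ [_ _ -> _ _]]]; last by rewrite leqnn.
  by have /andP[] := hS A AS.
exists S'; split=> //.
  apply: leq_trans leS'; rewrite cardsU; move: dN; rewrite -setI_eq0 => /eqP ->.
  rewrite cards0 subn0 -(cardsID Sk S) (setIidPr SkS) addnC leq_add2l; exact: leN.
move=> B /hS'[A /setUP[/S1P[AS _]|/NP[A0 [A0S _ _ sA0 _]]] sAB]; first by exists A.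
by exists A0 => //; apply: subset_trans sAB.
Qed.

End Push.

(** * Lexicographic weights *)

Section Weight.
Variables (T : finType) (n : nat) (idx : T -> nat).
Hypothesis idx_inj : injective idx.
Hypothesis idx_lt : forall x, (idx x < n)%N.
Implicit Types (A B C : {set T}).

(* Comparing weights is comparing sets lexicographically; additivity of [wt] makes this a
   monomial order on the exterior algebra. *)
Definition wt A : nat := \sum_(a in A) 2 ^ (n - idx a).

Lemma wtU A B : [disjoint A & B] -> wt (A :|: B) = (wt A + wt B)%N.
Proof. by move=> d; rewrite /wt -bigU //; apply: eq_bigl => z; rewrite !inE. Qed.

Lemma wt1 x : wt [set x] = (2 ^ (n - idx x))%N.
Proof. by rewrite /wt big_set1. Qed.

Lemma wtU1 x A : x \notin A -> wt (x |: A) = (2 ^ (n - idx x) + wt A)%N.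
Proof. by move=> xA; rewrite wtU ?wt1 // disjoints1. Qed.

Lemma wtD1 x A : x \in A -> wt A = (2 ^ (n - idx x) + wt (A :\ x))%N.
Proof. by move=> xA; rewrite -[in LHS](setD1K xA) wtU1 // !inE eqxx. Qed.

(** The exponents are distinct and lie below [n - k], so the sum is part of a geometric series. *)
Lemma wt_bound C k : (forall x, x \in C -> (k < idx x)%N) -> (wt C < 2 ^ (n - k))%N.
Proof.
move=> hC.
apply: (@leq_ltn_trans (\sum_(e < n - k) 2 ^ e)); last first.
  by elim: (n - k)%N => [|m IH]; rewrite ?big_ord0 // big_ord_recr expnS mul2n -addnn -addSn leq_add.
rewrite /wt; have hx x : x \in C -> (n - idx x < n - k)%N.
  by move=> /hC; have := idx_lt x; lia.
(* [inord] needs a successor, so the type has one value more than there are exponents; that value,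
   [n - k], is not attained on C. *)
pose g x : 'I_(n - k).+1 := inord (n - idx x).
rewrite (partition_big g xpredT) //= big_ord_recr /=.
rewrite [X in (_ + X)%N]big1 ?addn0; last first.
  move=> x /andP[xC /eqP/(congr1 val)] /=; have h := hx x xC.
  by rewrite /g inordK ?(ltn_trans h) // => e; rewrite e ltnn in h.
apply: leq_sum => e _.
case: (pickP [pred x | (x \in C) && (g x == widen_ord (leqnSn _) e)]) => [x /= hxe|h0]; last first.
  by rewrite big_pred0.
have gE z : z \in C -> g z == widen_ord (leqnSn (n - k)) e -> (n - idx z)%N = e.
  move=> zC /eqP/(congr1 val) /=; rewrite /g inordK //; have := hx z zC; lia.
rewrite (big_pred1 x) => [|z /=]; first by have /andP[xC /(gE _ xC)->] := hxe.
apply/idP/eqP => [/andP[zC /(gE _ zC) ez]|->//].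
have /andP[xC /(gE _ xC) ex] := hxe; apply: idx_inj.
have := hC _ zC; have := hC _ xC; have := idx_lt x; have := idx_lt z; lia.
Qed.

Lemma wt_lt B C x : x \in C -> (forall z, z \in B -> (idx x < idx z)%N) -> (wt B < wt C)%N.
Proof.
by move=> xC /wt_bound h; apply: leq_trans h _; rewrite (wtD1 xC) leq_addr.
Qed.

(** The element of least index in the symmetric difference outweighs the whole other side. *)
Lemma wt_inj : injective wt.
Proof.
move=> A B e; apply/eqP; apply: contraT => AB.
have {AB} : A :\: B :|: B :\: A != set0.
  apply: contraNneq AB => h; rewrite eqEsubset -!setD_eq0 -setU_eq0; exact/eqP.
case/set0Pn => x0 hx0.
have [x hx minx] := arg_minnP idx hx0.
have eqw : wt (A :\: B) = wt (B :\: A).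
  have hI : forall X Y : {set T}, wt X = (wt (X :&: Y) + wt (X :\: Y))%N.
    by move=> X Y; rewrite -wtU ?setID // -setI_eq0; apply/eqP/setP => z; rewrite !inE; case: (z \in Y); rewrite ?andbF.
  by apply/eqP; rewrite -(eqn_add2l (wt (A :&: B))) -hI setIC -hI e.
have ltx (X Y : {set T}) : x \in X :\: Y -> (forall z, z \in Y :\: X -> (idx x <= idx z)%N) ->
    (wt (Y :\: X) < wt (X :\: Y))%N.
  move=> xX h; apply: (wt_lt xX) => z zY; rewrite ltn_neqAle h // andbT.
  by apply: contraTneq zY => /idx_inj <-; move: xX; rewrite !inE => /andP[_ ->].
case/setUP: hx => hx.
  have := ltx A B hx; rewrite eqw ltnn; apply.
  by move=> z hz; apply: minx; apply/setUP; right.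
have := ltx B A hx; rewrite eqw ltnn; apply.
by move=> z hz; apply: minx; apply/setUP; left.
Qed.

Definition swap j z A := j |: A :\ z.

Lemma wt_swap j z A : z \in A -> j \notin A ->
  (wt (swap j z A) + 2 ^ (n - idx z) = wt A + 2 ^ (n - idx j))%N.
Proof.
move=> zA jA; rewrite /swap wtU1 ?(wtD1 zA); last by rewrite !inE (negbTE jA) andbF.
lia.
Qed.

Lemma wt_swap_lt j z A : (idx j < idx z)%N -> z \in A -> j \notin A -> (wt A < wt (swap j z A))%N.
Proof.
move=> jz zA jA; have := wt_swap zA jA.
have : (2 ^ (n - idx z) < 2 ^ (n - idx j))%N by rewrite ltn_exp2l //; have := idx_lt z; lia.
lia.
Qed.

Definition shift_closed j z (S : {set {set T}}) :=
  [forall A in S, (z \in A) ==> (j \notin A) ==> (swap j z A \in S)].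

Lemma shift_closedP j z (S : {set {set T}}) :
  reflect (forall A, A \in S -> z \in A -> j \notin A -> swap j z A \in S) (shift_closed j z S).
Proof.
apply: (iffP 'forall_implyP) => h A AS; last by apply/implyP => zA; apply/implyP => jA; apply: h.
by move=> zA jA; move: (h A AS); rewrite zA jA.
Qed.

Definition total_weight (S : {set {set T}}) : nat := \sum_(A in S) wt A.

(** Layer-cake summation. For families of leads the summands are ranks of truncations, so total
    weights can be compared threshold by threshold. *)
Lemma total_weightE (S : {set {set T}}) N : (forall A, A \in S -> (wt A <= N)%N) ->
  total_weight S = \sum_(M < N) #|[set A in S | (M < wt A)%N]|.
Proof.
move=> hN; under eq_bigr => M _ do rewrite -sum1_card.
have -> : \sum_(M < N) \sum_(i in [set A in S | (M < wt A)%N]) 1%N =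
          \sum_(M < N) \sum_(A in S) (M < wt A)%N.
  apply: eq_bigr => M _; rewrite [RHS](bigID (fun A => M < wt A)%N) /=.
  rewrite [X in (_ + X)%N]big1 ?addn0; last by move=> A /andP[_ /negbTE->].
  by apply: eq_big => A; [rewrite inE | rewrite inE => /andP[_ ->]].
rewrite exchange_big; apply: eq_bigr => A AS.
suff h m : \sum_(M < m) (M < wt A) = minn m (wt A) by rewrite h; apply/esym/minn_idPr/hN.
by elim: m => [|m IH]; rewrite ?big_ord0 ?min0n // big_ord_recr /= IH; lia.
Qed.

End Weight.

(** * Shifted families, lattice walks and the reflection count *)

Section Walk.
Variables (T : finType) (n : nat) (idx : T -> nat).
Hypothesis idx_inj : injective idx.
Hypothesis idx_lt : forall x, idx x < n.
Definition pre k : {set T} := [set x | idx x < k].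
Hypothesis card_pre : forall k, k <= n -> #|pre k| = k.
Implicit Types (A B : {set T}) (S : {set {set T}}).

Definition cnt A k := #|A :&: pre k|.

Lemma cnt_split A i k : i <= k -> cnt A k = cnt A i + #|A :&: pre k :\: pre i|.
Proof.
move=> ik; rewrite /cnt -(cardsID (pre i) (A :&: pre k)); congr (_ + _).
apply: eq_card => x; rewrite !inE; case: (x \in A) => //=.
by apply/andP/idP => [[]|h] //; split=> //; apply: leq_trans h ik.
Qed.

Lemma cnt_mono A i k : i <= k -> cnt A i <= cnt A k.
Proof. by move=> ik; rewrite (cnt_split A ik) leq_addr. Qed.

Lemma cnt_n A : cnt A n = #|A|.
Proof. by apply: eq_card => x; rewrite !inE idx_lt andbT. Qed.

Lemma cntC A k : k <= n -> cnt A k + #|pre k :\: A| = k.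
Proof. by move=> kn; rewrite /cnt setIC cardsID card_pre. Qed.

(* Reading the elements in order as up and down steps, this is the last return of the walk of
   [A] to height 0; complementing [A] before it is a reflection. *)
Definition lastk A := \max_(k < n.+1 | (cnt A k).*2 == k) k.

Lemma lastkP A : (cnt A (lastk A)).*2 = lastk A /\ lastk A <= n.
Proof.
have [|k /eqP hk ek] := @eq_bigmax_cond _ [pred k : 'I_n.+1 | (cnt A k).*2 == k] (@nat_of_ord _).
  apply/card_gt0P; exists ord0; rewrite inE /= /cnt.
  by rewrite eq_card0 // => x; rewrite !inE andbF.
by rewrite /lastk; have -> := ek; rewrite hk -ltnS.
Qed.

Lemma lastk_max A k : k <= n -> (cnt A k).*2 = k -> k <= lastk A.
Proof.
move=> kn hk; have hkn : k < n.+1 by [].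
apply: (@leq_bigmax_cond _ [pred k : 'I_n.+1 | (cnt A k).*2 == k] (@nat_of_ord _) (Ordinal hkn)).
by rewrite inE /= hk.
Qed.

(** The walk has height [k - 2 * cnt A k] at time k and ends at a nonnegative height. Were it
    negative after its last zero, it would stay negative to the end, since unit steps cannot cross 0
    without touching it. *)
Lemma lastk_gt A k : #|A|.*2 <= n -> lastk A < k -> k <= n -> (cnt A k).*2 < k.
Proof.
move=> hA lk kn; rewrite ltnNge; apply/negP => h.
suff : n < (cnt A n).*2 by rewrite cnt_n ltnNge hA.
suff H m : k <= m -> m <= n -> m < (cnt A m).*2 by apply: H.
elim: m => [|m IH] km mn.
  by move: lk; have -> : k = 0 by lia.
suff : m < (cnt A m.+1).*2.
  rewrite leq_eqVlt => /orP[/eqP e|//].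
  by have := lastk_max mn (esym e); lia.
case: (ltngtP k m.+1) km => // [km _|<- _]; last by lia.
by apply: leq_trans (IH _ _) _; rewrite ?leq_double ?cnt_mono //; lia.
Qed.

Definition flip A := (pre (lastk A) :\: A) :|: (A :\: pre (lastk A)).

Lemma cnt_flip_le A k : k <= lastk A -> cnt A k + cnt (flip A) k = k.
Proof.
move=> kl; have kn : k <= n by apply: leq_trans kl _; case: (lastkP A).
rewrite -[RHS](cntC A kn); congr (_ + _); apply: eq_card => x; rewrite !inE.
case: (ltnP (idx x) k) => xk; rewrite ?andbF //= !andbT.
by rewrite (leq_trans xk kl) /= orbF andbT.
Qed.

Lemma cnt_flip_ge A k : lastk A <= k -> cnt (flip A) k = cnt A k.
Proof.
move=> lk; rewrite !(cnt_split _ lk); congr (_ + _).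
  by have [h _] := lastkP A; have := cnt_flip_le (leqnn (lastk A)); lia.
apply: eq_card => x; rewrite !inE.
by case: (idx x < lastk A); rewrite /= ?andbF.
Qed.

Lemma card_flip A : #|flip A| = #|A|.
Proof. by rewrite -!cnt_n cnt_flip_ge //; case: (lastkP A). Qed.

Lemma lastk_flip A : lastk (flip A) = lastk A.
Proof.
have [h1 h2] := lastkP A; have [h3 h4] := lastkP (flip A).
apply/eqP; rewrite eqn_leq; apply/andP; split; last first.
  by apply: lastk_max => //; rewrite cnt_flip_ge.
case: (leqP (lastk A) (lastk (flip A))) => h; last exact: ltnW.
by apply: lastk_max => //; rewrite -(cnt_flip_ge h).
Qed.

Lemma flipK : involutive flip.
Proof.
move=> A; apply/setP => x; rewrite /flip -/(flip A) lastk_flip !inE.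
by case: (idx x < lastk A); case: (x \in A).
Qed.

Lemma flip_sum_le A k : #|A|.*2 <= n -> k <= n -> cnt A k + cnt (flip A) k <= k.
Proof.
move=> hA kn; case: (leqP k (lastk A)) => h; first by rewrite cnt_flip_le.
by have := lastk_gt hA h kn; rewrite cnt_flip_ge ?(ltnW h) //; lia.
Qed.

Definition shifted S := forall j z, idx j < idx z -> shift_closed j z S.

Lemma cntU A B k : cnt A k + cnt B k = #|(A :|: B) :&: pre k| + #|A :&: B :&: pre k|.
Proof.
rewrite /cnt setIUl -cardsUI; congr (_ + _); apply: eq_card => x; rewrite !inE.
by case: (_ < _); rewrite ?andbT ?andbF.
Qed.

Lemma gap A B k j : k <= n -> j \in pre k -> j \notin A :|: B -> #|(A :|: B) :&: pre k| < k.
Proof.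
move=> kn jk jAB; rewrite -[X in _ < X](card_pre kn); apply: proper_card.
apply/properP; split; first exact: subsetIr.
by exists j => //; rewrite inE (negbTE jAB).
Qed.

(** Induction on the size of the intersection. If x is the first common element, the count condition
    at the prefix ending in x leaves an element j of that prefix outside A and B, and x is replaced
    by j in B. *)
Lemma shifted_disjoint S A B : shifted S -> B \in S ->
  (forall k, k <= n -> cnt A k + cnt B k <= k) -> exists2 B', B' \in S & A :&: B' = set0.
Proof.
move=> hS; have [m] := ubnP #|A :&: B|; elim: m B => // m IH B hm BS hc.
case: (set_0Vmem (A :&: B)) => [e|[x0 hx0]]; first by exists B.
have [x /setIP[xA xB] minx] := arg_minnP idx hx0.
have pn : (idx x).+1 <= n by [].
have xp : x \in A :&: B :&: pre (idx x).+1 by rewrite !inE xA xB ltnSn.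
have [j jp jAB] : exists2 j, j \in pre (idx x).+1 & j \notin A :|: B.
  suff : ~~ (pre (idx x).+1 \subset (A :|: B) :&: pre (idx x).+1).
    by case/subsetPn => j jp; rewrite inE jp andbT => h; exists j.
  apply/negP => /subset_leq_card; rewrite card_pre // => h.
  have := hc _ pn; rewrite cntU (cardsD1 x (A :&: B :&: _)) xp; lia.
have [jA jB] : j \notin A /\ j \notin B by apply/andP; rewrite -negb_or -in_setU.
have jx : idx j < idx x.
  move: jp; rewrite inE ltnS leq_eqVlt => /orP[/eqP/idx_inj e|//].
  by rewrite e xA in jA.
have B'S : swap j x B \in S by apply: (shift_closedP _ _ _ (hS j x jx)).
apply: (IH _ _ B'S).
  apply: leq_trans (hm : _ <= m); apply: proper_card; apply/properP; split.
    apply/subsetP => y; rewrite !inE => /andP[yA]; rewrite yA.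
    by case: eqP yA => [->|_ _ /andP[]//]; rewrite (negbTE jA).
  exists x; first by rewrite inE xA.
  by rewrite !inE xA eqxx /= orbF; apply: contraNneq jA => <-.
(* The count condition survives the swap: a prefix reaching x loses x and gains j; a shorter one
   containing j has no common element and misses j in the union, which leaves room for one more. *)
move=> k kn; case: (leqP k (idx x)) => kx.
  case: (boolP (j \in pre k)) => jk; last first.
    apply: leq_trans (hc k kn); rewrite leq_add2l; apply: subset_leq_card.
    apply/subsetP => y; rewrite !inE => /andP[/orP[/eqP->|/andP[_ ->]] //].
    by move: jk; rewrite inE => /negbTE ->.
  have lt := gap kn jk jAB.
  have : cnt (swap j x B) k <= (cnt B k).+1.
    rewrite /cnt -add1n -(cards1 j) -cardsUI; apply: leq_trans (leq_addr _ _).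
    apply: subset_leq_card; apply/subsetP => y; rewrite !inE.
    by case/andP => /orP[->//|/andP[_ ->]] ->; rewrite orbT.
  move=> le; apply: leq_trans (_ : (cnt A k + cnt B k).+1 <= k).
    by rewrite -addnS leq_add2l.
  rewrite cntU (_ : A :&: B :&: pre k = set0) ?cards0 ?addn0 //.
  apply/setP => y; rewrite !inE; apply/negbTE; rewrite -!andbA; apply/negP => /and3P[yA yB yk].
  have yAB : y \in A :&: B by rewrite inE yA.
  by have := minx y yAB; rewrite leqNgt (leq_trans yk kx).
apply: leq_trans (hc k kn); rewrite leq_add2l.
rewrite /cnt (cardsD1 x (B :&: _)) !inE xB kx add1n.
apply: (@leq_trans #|j |: ((B :&: pre k) :\ x)|); last by rewrite cardsU1; case: (_ \notin _).
apply: subset_leq_card; apply/subsetP => y; rewrite !inE.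
by case/andP => /orP[->//|/andP[-> ->]] ->; rewrite orbT.
Qed.

(** A member with the most elements in [pre r] must be [pre r], since otherwise a swap would
    increase that number. *)
Lemma shifted_pre S r : r <= n -> shifted S -> S != set0 ->
  (forall A, A \in S -> #|A| = r) -> pre r \in S.
Proof.
move=> rn hS /set0Pn[A0 A0S] card_S.
have [A AS maxA] := arg_maxnP (fun A => #|A :&: pre r|) A0S.
suff -> : pre r = A by [].
apply/eqP; rewrite eqEcard (card_S A AS) card_pre // leqnn andbT.
apply: contraT => /subsetPn[j jr jA].
have [z zA zr] : exists2 z, z \in A & z \notin pre r.
  apply/subsetPn; apply: contra jA => sA.
  suff -> : A = pre r by [].
  by apply/eqP; rewrite eqEcard sA (card_S A AS) card_pre //=.
have jz : idx j < idx z by move: jr zr; rewrite !inE -leqNgt; apply: leq_trans.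
have A'S := shift_closedP _ _ _ (hS j z jz) A AS zA jA.
have le : #|swap j z A :&: pre r| <= #|A :&: pre r| := maxA _ A'S.
move: le; rewrite leqNgt => /negP[]; apply: proper_card; apply/properP; split.
  apply/subsetP => y /setIP[yA yr]; rewrite inE yr andbT !inE yA andbT orbC.
  by rewrite (_ : y != z) //; apply: contraNneq zr => <-.
by exists j; rewrite !inE ?(negbTE jA) // eqxx; rewrite inE in jr.
Qed.

Lemma cross_bound (Om S1 S2 : {set {set T}}) r : r.*2 <= n ->
  (forall A, A \in Om -> #|A| = r) -> (forall A, A \in Om -> flip A \in Om) ->
  S1 \subset Om -> S2 \subset Om -> S1 != set0 -> S2 != set0 ->
  shifted S1 -> shifted S2 -> cross_intersecting S1 S2 ->
  #|S1| + #|S2| + #|[set A in Om | [disjoint A & pre r]]| <= #|Om| + 1.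
Proof.
move=> rn cardOm flipOm sS1 sS2 nS1 nS2 hS1 hS2 cross.
have rn' : r <= n by lia.
have card1 A : A \in S1 -> #|A| = r by move/(subsetP sS1)/cardOm.
have card2 A : A \in S2 -> #|A| = r by move/(subsetP sS2)/cardOm.
set V := pre r; have V1 : V \in S1 by apply: shifted_pre.
have V2 : V \in S2 by apply: shifted_pre.
have VOm : V \in Om by apply: (subsetP sS1).
(* V lies in both families but is a single set of [Om]; this is the origin of the 1 in the bound. *)
pose X := [set A in Om | ~~ [disjoint A & V]] :\ V.
pose P := flip @: (S2 :\ V).
have flip_inj : injective flip by apply: inv_inj flipK.
have cP : #|P| = #|S2 :\ V| by rewrite card_imset.
have dis A : [disjoint A & V] = (A :&: V == set0) by rewrite setI_eq0.
have sX1 : S1 :\ V \subset X.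
  apply/subsetP => A /setD1P[AV A1]; rewrite !inE AV (subsetP sS1) //= dis.
  exact: cross.
have meet2 B : B \in S2 -> B :&: V != set0 by move=> B2; rewrite setIC; apply: cross.
(* The walk of V takes r steps down and is back at height 0 after 2r steps, so the reflection of V
   is disjoint from V. *)
have lV : r.*2 <= lastk V.
  apply: lastk_max => //; rewrite /cnt /V (setIidPl _) ?card_pre //.
  by apply/subsetP => x; rewrite !inE => xr; apply: leq_trans xr _; rewrite -addnn leq_addr.
have flipV : flip V :&: V = set0.
  apply/setP => x; rewrite [RHS]inE; apply/negbTE/negP => /setIP[].
  rewrite /flip in_setU !in_setD => + xV; rewrite xV /= andbT !inE.
  by move: xV lV; rewrite inE; clear; lia.
have sX2 : P \subset X.
  apply/subsetP => _ /imsetP[B /setD1P[BV B2] ->].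
  rewrite !inE flipOm ?(subsetP sS2) // dis; apply/and3P; split=> //.
    by apply: contraNneq (meet2 B B2) => e; rewrite -(flipK B) e flipV.
  (* Suppose the reflection of B misses V. If the last zero is at r or later, B contains V and so
     equals V. If it is earlier, B contains the whole prefix up to it, which must then be empty; so
     B is its own reflection and misses V, although V is in [S1]. *)
  apply/negP => /eqP e; have [l1 l2] := lastkP B.
  case: (leqP r (lastk B)) => h.
    suff : V \subset B.
      move=> sVB; move: BV; rewrite eq_sym eqEcard sVB card2 //= /V card_pre //.
      by rewrite leqnn.
    apply/subsetP => x; rewrite inE => xr; have /setP/(_ x) := e.
    by rewrite !inE xr (leq_trans xr h) /= !andbT orbF => /negbFE.
  have l0 : lastk B = 0.
    suff : pre (lastk B) \subset B.
      move=> sB; move: l1; rewrite /cnt (setIidPr sB) card_pre //; clear; lia.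
    apply/subsetP => x; rewrite inE => xl; have /setP/(_ x) := e.
    by rewrite !inE (ltn_trans xl h) xl /= !andbT orbF => /negbFE.
  have : flip B = B by apply/setP => x; rewrite !inE l0 /= andbF.
  by move=> eB; have := meet2 B B2; rewrite -{1}eB e eqxx.
have dP : [disjoint S1 :\ V & P].
  rewrite -setI_eq0; apply/eqP/setP => A; rewrite inE [RHS]inE; apply/negbTE/negP.
  case/andP => /setD1P[_ A1] /imsetP[B /setD1P[_ B2] eA].
  have eB : B = flip A by rewrite eA flipK.
  have [|B' B'2 e] := @shifted_disjoint S2 A B hS2 B2.
    by move=> k kn; rewrite eB; apply: flip_sum_le => //; rewrite card1.
  by have := cross A B' A1 B'2; rewrite e eqxx.
have le : #|S1 :\ V| + #|S2 :\ V| <= #|X|.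
  have -> : #|S1 :\ V| + #|S2 :\ V| = #|(S1 :\ V) :|: P|.
    by rewrite cardsU -cP; move: dP; rewrite -setI_eq0 => /eqP ->; rewrite cards0 subn0.
  by apply: subset_leq_card; rewrite subUset sX1.
have eOm : #|Om| = #|[set A in Om | [disjoint A & V]]| + #|X|.+1.
  rewrite -(cardsID [set A : {set T} | [disjoint A & V]] Om); congr (_ + _).
    by apply: eq_card => A; rewrite !inE.
  rewrite (cardsD1 V) in_setD VOm !inE dis setIid.
  have -> : V != set0.
    by have := meet2 V V2; rewrite setIid.
  rewrite add1n; congr _.+1; apply: eq_card => A; rewrite !inE; case: (A == V) => //=.
  by rewrite andbC.
rewrite -/V eOm (cardsD1 V S1) V1 (cardsD1 V S2) V2; rewrite [X in X <= _]addnC -[X in _ <= X]addnA leq_add2l.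
by rewrite /= addnACA addnC !addn1 addn2 !ltnS.
Qed.

End Walk.

(** * Contractions and multiplications in the exterior algebra *)

Local Open Scope ring_scope.

(* A chain over [A] is an element of the exterior algebra on [T]: [u B] is its coordinate on
   the monomial of [B], ordered by [enum_rank]; [eps x] is multiplication by the generator [x],
   [ctr x] the dual contraction, and [ct l] contraction by the functional [l]. *)
Definition chain (T : finType) (A : Type) := {ffun {set T} -> A}.
HB.instance Definition _ (T : finType) (A : comNzRingType) :=
  GRing.Lmodule.copy (chain T A) {ffun {set T} -> A^o}.

Section Operators.
Variables (T : finType) (A : comNzRingType).
Implicit Types (u w : chain T A) (B : {set T}) (x y : T).

Lemma chainZE (a : A) u B : (a *: u) B = a * u B.
Proof. by rewrite ffunE. Qed.

Definition sg B x : A := (-1) ^+ #|[set y in B | (enum_rank y < enum_rank x)%N]|.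

Definition ctr x u : chain T A :=
  [ffun B : {set T} => if x \in B then 0 else sg B x * u (x |: B)].

Definition eps x u : chain T A :=
  [ffun B : {set T} => if x \in B then sg B x * u (B :\ x) else 0].

Definition ct (l : T -> A) u : chain T A := \sum_x l x *: ctr x u.

Lemma sg_sqr B x : sg B x * sg B x = 1.
Proof. by rewrite /sg -expr2 sqrr_sign. Qed.

Lemma sgU1 B x : sg (x |: B) x = sg B x.
Proof.
rewrite /sg; congr (_ ^+ _); apply: eq_card => y; rewrite !inE.
by case: eqP => // ->; rewrite ltnn !andbF.
Qed.

Lemma sgD1 B x : sg (B :\ x) x = sg B x.
Proof.
rewrite /sg; congr (_ ^+ _); apply: eq_card => y; rewrite !inE.
by case: eqP => // ->; rewrite ltnn !andbF.
Qed.

Lemma sgU B x y : y \notin B ->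
  sg (y |: B) x = (-1) ^+ (enum_rank y < enum_rank x)%N * sg B x.
Proof.
move=> yB; rewrite /sg -exprD; congr (_ ^+ _).
have -> : [set z in y |: B | (enum_rank z < enum_rank x)%N] =
  [set z in [set y] | (enum_rank z < enum_rank x)%N]
    :|: [set z in B | (enum_rank z < enum_rank x)%N].
  by apply/setP => z; rewrite !inE andb_orl.
rewrite cardsU disjoint_setI0 ?cards0 ?subn0; last first.
  rewrite -setI_eq0; apply/eqP/setP => z; rewrite !inE.
  by case: eqP => [->|//]; rewrite (negbTE yB) andbF.
congr (_ + _)%N; case: ltnP => h.
  by apply/eqP/cards1P; exists y; apply/setP => z; rewrite !inE; case: eqP => // ->.
by apply: eq_card0 => z; rewrite !inE; case: eqP => // ->; rewrite ltnNge h.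
Qed.

Lemma sg_anti B x y : x != y -> x \notin B -> y \notin B ->
  sg B x * sg (x |: B) y = - (sg B y * sg (y |: B) x).
Proof.
move=> xy xB yB; rewrite !sgU //.
have: enum_rank x != enum_rank y by rewrite (inj_eq enum_rank_inj).
rewrite -(inj_eq val_inj) /= neq_ltn => /orP[] h.
  by rewrite h ltnNge ltnW //= expr1 expr0 mulN1r mul1r mulrN mulrC.
by rewrite h ltnNge ltnW //= expr1 expr0 mulN1r mul1r mulrN opprK mulrC.
Qed.

Lemma ctr_is_linear x : linear (ctr x).
Proof.
move=> a u w; apply/ffunP => B; rewrite !(chainZE, ffunE); case: ifP => _.
  by rewrite mulr0 addr0.
by rewrite mulrDr !mulrA [sg _ _ * a]mulrC.
Qed.
HB.instance Definition _ x := GRing.isLinear.Build A _ _ _ (ctr x) (ctr_is_linear x).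

Lemma eps_is_linear x : linear (eps x).
Proof.
move=> a u w; apply/ffunP => B; rewrite !(chainZE, ffunE); case: ifP => _; last first.
  by rewrite mulr0 addr0.
by rewrite mulrDr !mulrA [sg _ _ * a]mulrC.
Qed.
HB.instance Definition _ x := GRing.isLinear.Build A _ _ _ (eps x) (eps_is_linear x).

Lemma ct_is_linear l : linear (ct l).
Proof.
move=> a u w; rewrite /ct scaler_sumr -big_split /=; apply: eq_bigr => x _.
by rewrite linearP scalerDr !scalerA mulrC.
Qed.
HB.instance Definition _ l := GRing.isLinear.Build A _ _ _ (ct l) (ct_is_linear l).

Lemma ctr_ctr x y u : ctr x (ctr y u) = - ctr y (ctr x u).
Proof.
apply/ffunP => B; rewrite !ffunE !inE.
case: (eqVneq x y) => [<-|xy].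
  by case: ifP => //=; rewrite ?oppr0 ?mulr0 ?oppr0.
case: (boolP (x \in B)) => xB; case: (boolP (y \in B)) => yB;
  rewrite ?orbT ?orbF ?mulr0 ?oppr0 //=.
by rewrite !mulrA sg_anti // mulNr setUCA.
Qed.

Lemma eps_eps x y u : eps x (eps y u) = - eps y (eps x u).
Proof.
apply/ffunP => B; rewrite !ffunE !inE.
case: (eqVneq x y) => [<-|xy].
  by case: ifP => //=; rewrite ?oppr0 ?mulr0 ?oppr0.
case: (boolP (x \in B)) => xB; case: (boolP (y \in B)) => yB;
  rewrite ?andbF ?andbT ?mulr0 ?oppr0 //=.
rewrite !mulrA.
set C := B :\ x :\ y.
have xC : x \notin C by rewrite !inE eqxx andbF.
have yC : y \notin C by rewrite !inE eqxx.
have eB : B = x |: (y |: C).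
  by apply/setP => z; rewrite !inE; case: eqP => [->|_] //=; case: eqP => [->|].
have -> : B :\ y :\ x = C by apply/setP => z; rewrite !inE andbCA.
have -> : sg (B :\ x) y = sg C y by rewrite -[in RHS]sgD1 /C -(sgD1 (B :\ x)) setDK' // || rewrite /C sgD1.
have -> : sg (B :\ y) x = sg C x.
  have -> : B :\ y = x |: C.
    by apply/setP => z; rewrite eB !inE; case: (eqVneq z x) => [->|_] //=;
      case: (eqVneq z y) => //=; rewrite ?xy.
  by rewrite sgU1.
have -> : sg B x = sg (y |: C) x by rewrite eB sgU1.
have -> : sg B y = sg (x |: C) y by rewrite eB setUCA sgU1.
by rewrite [sg (y |: C) x * _]mulrC [sg (x |: C) y * _]mulrC sg_anti 1?eq_sym // mulNr.
Qed.

Lemma ctr_eps x y u : ctr x (eps y u) = (x == y)%:R *: u - eps y (ctr x u).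
Proof.
apply/ffunP => B; rewrite !(chainZE, ffunE) !inE.
case: (eqVneq x y) => [<-|xy] /=.
  rewrite mul1r; case: (boolP (x \in B)) => xB.
    by rewrite /= mulrA sgD1 sg_sqr mul1r setD1K // subrr.
  by rewrite subr0 mulrA sgU1 sg_sqr mul1r setU1K.
rewrite mul0r add0r; case: (boolP (x \in B)) => xB.
  by case: ifP => _; rewrite ?mulr0 oppr0.
case: (boolP (y \in B)) => yB; rewrite ?[y == x]eq_sym ?(negbTE xy) /= ?mulr0 ?oppr0 //.
set C := B :\ y.
have xC : x \notin C by rewrite !inE (negbTE xB) andbF.
have yC : y \notin C by rewrite !inE eqxx.
have eB : B = y |: C by rewrite setD1K.
have -> : (x |: B) :\ y = x |: C.
  by apply/setP => z; rewrite !inE; case: (eqVneq z y) => [->|] //=; rewrite eq_sym (negbTE xy).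
rewrite !mulrA eB setUCA !sgU1 -mulNr; congr (_ * _).
have -> : sg (x |: C) y = - (sg C x * sg C y * sg (y |: C) x).
  by rewrite -mulrA -mulrN -sg_anti // mulrA sg_sqr mul1r.
by rewrite mulrN mulrCA sg_sqr mulr1 mulrC.
Qed.

Lemma ct_ctr l x u : ct l (ctr x u) = - ctr x (ct l u).
Proof.
rewrite /ct linear_sum /= -sumrN; apply: eq_bigr => y _.
by rewrite linearZ /= ctr_ctr scalerN.
Qed.

Lemma ct_ct l m u : ct l (ct m u) = - ct m (ct l u).
Proof.
rewrite {2 3}/ct linear_sum /= -sumrN; apply: eq_bigr => x _.
by rewrite linearZ /= ct_ctr scalerN.
Qed.

Lemma ctr_sqr x u : ctr x (ctr x u) = 0.
Proof. by apply/ffunP => B; rewrite !ffunE setU11; case: ifP; rewrite ?mulr0. Qed.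

(** Anticommutation ([ct_ct]) only shows that twice the left side vanishes, which says nothing in
    characteristic 2; instead the cross terms are cancelled in pairs by induction on the list of
    vertices. *)
Lemma ct_sqr l u : ct l (ct l u) = 0.
Proof.
rewrite /ct; elim: (index_enum T) => [|x r IH]; first by rewrite big_nil.
rewrite !big_cons; set S := fun u : chain T A => \sum_(j <- r) l j *: ctr j u.
have SD v w : S (v + w) = S v + S w.
  by rewrite /S -big_split; apply: eq_bigr => y _; rewrite linearD scalerDr.
have Sx v : S (l x *: ctr x v) = - (l x *: ctr x (S v)).
  rewrite /S linear_sum scaler_sumr -sumrN; apply: eq_bigr => y _ /=.
  by rewrite !linearZ /= ctr_ctr !scalerN !scalerA mulrC.
rewrite -[\sum_(j <- r) _ *: ctr j u]/(S u) -[X in _ + X]/(S (l x *: ctr x u + S u)) SD Sx.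
rewrite linearD linearZ /= ctr_sqr !scaler0 add0r addrA subrr add0r.
exact: IH.
Qed.

Lemma ct_eps l x u : ct l (eps x u) = l x *: u - eps x (ct l u).
Proof.
rewrite /ct linear_sum /=.
under eq_bigr => y _ do rewrite ctr_eps scalerBr scalerA.
rewrite sumrB (bigD1 x) //= eqxx mulr1 big1 ?addr0; last first.
  by move=> y /negbTE->; rewrite mulr0 scale0r.
by congr (_ - _); apply: eq_bigr => y _; rewrite linearZ.
Qed.

Lemma ctE l u B :
  ct l u B = \sum_(x in ~: B) sg B x * l x * u (x |: B).
Proof.
rewrite /ct sum_ffunE (bigID (mem B)) /= big1 ?add0r; last first.
  by move=> x xB; rewrite chainZE ffunE xB mulr0.
apply: eq_big => x; first by rewrite inE.
by move=> /negbTE xB; rewrite chainZE ffunE xB mulrA [l x * _]mulrC.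
Qed.

End Operators.

(** * Acyclicity over extensions of the field *)

Section Carried.
Variables (T : finType).

Definition faces (D : {set {set T}}) k : {set {set T}} := [set B : {set T} in D | #|B| == k].

Lemma facesP (D : {set {set T}}) k (B : {set T}) : reflect (B \in D /\ #|B| = k) (B \in faces D k).
Proof. by rewrite inE; apply: (iffP andP) => -[-> /eqP]. Qed.

Definition carried (A : comNzRingType) (S : {set {set T}}) (u : chain T A) :=
  forall B, B \notin S -> u B = 0.

Lemma bdE (F : fieldType) (c : {ffun {set T} -> F}) :
  bd c = ct (fun=> 1) (c : chain T F).
Proof.
apply/ffunP => B; rewrite ctE ffunE; apply: eq_bigr => x _.
by rewrite mulr1.
Qed.

Lemma supportedP (F : fieldType) (D : {set {set T}}) k (c : {ffun {set T} -> F}) :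
  supported D k c <-> carried (faces D k) (c : chain T F).
Proof.
split=> h B.
  by move=> hB; apply/eqP; apply: contraNT hB => /h /facesP.
by move=> hB; apply/facesP; apply: contraNT hB => /h ->.
Qed.

Variable F : fieldType.

(* Exactness over F provides a contracting homotopy with coefficients in F,
   which then gives exactness over every F-algebra. *)
Lemma rhom_vanish_algebra (D : {set {set T}}) k : rhom_vanish F D k ->
  exists s : {set T} -> {set T} -> F, forall (A : comNzRingType) (i : {rmorphism F -> A})
    (u : chain T A), carried (faces D k) u -> ct (fun=> 1) u = 0 ->
    let w : chain T A := [ffun B : {set T} => \sum_X i (s X B) * u X] in
    carried (faces D k.+1) w /\ ct (fun=> 1) w = u.
Proof.
move=> ex.
pose bc (X B : {set T}) : F := \sum_(x | (x \notin B) && (x |: B == X)) sg F B x.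
have bcE (A : comNzRingType) (i : {rmorphism F -> A}) (u : chain T A) B :
    ct (fun=> 1) u B = \sum_X u X * i (bc X B).
  rewrite ctE; under [RHS]eq_bigr => X _ do rewrite rmorph_sum mulr_sumr.
  rewrite (exchange_big_dep (mem (~: B))) /=; last by move=> X x _ /andP[]; rewrite inE.
  apply: eq_bigr => x; rewrite inE => xB; rewrite (big_pred1 (x |: B)) => [|X].
    by rewrite mulr1 mulrC /sg rmorph_sign.
  by rewrite xB eq_sym.
pose N := #|{: {set T}}|.
pose ev (j : 'I_N) : {set T} := enum_val j.
have sumN (A : comNzRingType) (f : {set T} -> A) : \sum_X f X = \sum_(j < N) f (ev j).
  rewrite (reindex (fun j : 'I_N => ev j)) //.
  by exists enum_rank => x _; rewrite /ev ?enum_valK ?enum_rankK.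
pose G := faces D k.
pose M0 : 'M[F]_N := \matrix_(a, b) (if ev a \in G then bc (ev a) (ev b) else 0).
(* [M0] is the boundary matrix on k-faces, acting on row vectors. The rows of [R], restricted to
   k-faces, are cycles, and multiplication by [R] fixes every cycle, with coefficients in any
   extension; so it suffices to choose a primitive of each row. *)
pose R := 1%:M - M0 *m pinvmx M0.
have R0 : R *m M0 = 0 by rewrite mulmxBl mul1mx mulmxKpV ?subrr.
have exd a : exists d : chain T F, carried (faces D k.+1) d /\
    forall b, ct (fun=> 1) d (ev b) = if ev b \in G then R a b else 0.
  pose c : chain T F := [ffun X : {set T} => if X \in G then R a (enum_rank X) else 0].
  case: (ex c).
  - by apply/supportedP => B hB; rewrite ffunE (negbTE hB).
  - rewrite bdE; apply/ffunP => B; rewrite (bcE F idfun) sumN ffunE.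
    have /matrixP/(_ a (enum_rank B)) := R0; rewrite [LHS]mxE [RHS]mxE => R0aB.
    apply: etrans R0aB; apply: eq_bigr => j _.
    rewrite ffunE [M0 _ _]mxE /ev enum_rankK enum_valK.
    by case: ifP => _; rewrite ?mul0r ?mulr0.
  move=> d [/supportedP hd]; rewrite bdE => e; exists d; split=> // b.
  by rewrite e ffunE enum_valK.
case/fin_all_exists: exd => d hd.
exists (fun X B => d (enum_rank X) B) => A i u hu bu w.
have wE B : w B = \sum_(a < N) i (d a B) * u (ev a).
  by rewrite ffunE sumN; apply: eq_bigr => a _; rewrite enum_valK.
split=> [B hB|].
  by rewrite wE big1 // => a _; rewrite (hd a).1 // rmorph0 mul0r.
apply/ffunP => B; rewrite (bcE A i) sumN.
transitivity (\sum_(a < N) u (ev a) * i (ct (fun=> 1) (d a) B)).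
  under eq_bigr => b _ do rewrite wE mulr_suml.
  rewrite exchange_big; apply: eq_bigr => a _.
  rewrite (bcE F idfun) sumN rmorph_sum mulr_sumr; apply: eq_bigr => b _.
  by rewrite rmorphM mulrAC mulrC.
have eB : B = ev (enum_rank B) by rewrite /ev enum_rankK.
have dE a : ct (fun=> 1) (d a) B = if B \in G then R a (enum_rank B) else 0.
  by rewrite [in LHS]eB (hd a).2 -eB.
under eq_bigr do rewrite dE.
case: (boolP (B \in G)) => BG; last first.
  by rewrite (hu _ BG) big1 // => a _; rewrite rmorph0 mulr0.
have RE a b : R a b = (a == b)%:R - \sum_c M0 a c * pinvmx M0 c b.
  by rewrite mxE [(1%:M : 'M_N) _ _]mxE [(- _ : 'M_N) _ _]mxE [(_ *m _ : 'M_N) _ _]mxE.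
under eq_bigr => a _ do rewrite RE rmorphB mulrBr.
rewrite sumrB (bigD1 (enum_rank B)) //= eqxx rmorph1 mulr1 big1 ?addr0; last first.
  by move=> a /negbTE ->; rewrite rmorph0 mulr0.
rewrite -eB -[RHS]subr0; congr (_ - _).
under eq_bigr => a _ do rewrite rmorph_sum mulr_sumr.
rewrite exchange_big big1 // => b _.
under eq_bigr => a _ do rewrite rmorphM mulrA.
rewrite -mulr_suml; suff -> : \sum_(a < N) u (ev a) * i (M0 a b) = 0 by rewrite mul0r.
transitivity (ct (fun=> 1) u (ev b)); last by rewrite bu ffunE.
rewrite (bcE A i) sumN; apply: eq_bigr => a _; rewrite mxE.
by case: ifPn => // h; rewrite (hu _ h) !mul0r.
Qed.

End Carried.

(* A graded domain whose part of degree 0 is [K]; iterating [gpoly] gives polynomial rings. *)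
Record gring (K : fieldType) := Gring {
  gcar :> idomainType;
  gemb : {rmorphism K -> gcar};
  ghom : nat -> gcar -> Prop;
  ghom0 : forall e, ghom e 0;
  ghomD : forall e a b, ghom e a -> ghom e b -> ghom e (a + b);
  ghomM : forall e f a b, ghom e a -> ghom f b -> ghom (e + f) (a * b);
  ghomC : forall c, ghom 0 (gemb c);
  ghom_deg0 : forall a, ghom 0 a -> exists c, a = gemb c }.

Arguments gemb {K} G : rename.
Arguments ghom {K} G : rename.

(** * Graded domains and their polynomial extensions *)

Section GRingTheory.
Variables (K : fieldType).
Implicit Types (G : gring K).

Lemma ghomN G e (a : G) : ghom G e a -> ghom G e (- a).
Proof.
by move=> ha; rewrite -mulN1r -(rmorphN1 (gemb G)) -[e]add0n; apply: ghomM => //; apply: ghomC.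
Qed.

Lemma ghomB G e (a b : G) : ghom G e a -> ghom G e b -> ghom G e (a - b).
Proof. by move=> ha hb; apply: ghomD => //; apply: ghomN. Qed.

Lemma ghom1 G : ghom G 0 1.
Proof. by rewrite -(rmorph1 (gemb G)); apply: ghomC. Qed.

Lemma ghomZ G e c (a : G) : ghom G e a -> ghom G e (gemb G c * a).
Proof. by move=> ha; rewrite -[e]add0n; apply: ghomM => //; apply: ghomC. Qed.

Lemma ghom_sum G e (I : Type) (r : seq I) (P : pred I) (f : I -> G) :
  (forall i, P i -> ghom G e (f i)) -> ghom G e (\sum_(i <- r | P i) f i).
Proof. by move=> h; elim/big_ind: _ => //; [apply: ghom0 | apply: ghomD]. Qed.

Lemma ghom_sign G e (n : nat) (a : G) : ghom G e a -> ghom G e ((-1) ^+ n * a).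
Proof. by move=> ha; rewrite -(rmorph_sign (gemb G)); apply: ghomZ. Qed.

Lemma ghomX G (a : G) i : ghom G 1 a -> ghom G i (a ^+ i).
Proof.
move=> ha; elim: i => [|i IH]; first by rewrite expr0; apply: ghom1.
by rewrite exprS -add1n; apply: ghomM.
Qed.

Definition base_hom e (a : K) := (0 < e)%N -> a = 0.

Lemma base_homM e f (a b : K) : base_hom e a -> base_hom f b -> base_hom (e + f) (a * b).
Proof.
move=> ha hb; rewrite /base_hom addn_gt0 => /orP[/ha->|/hb->]; first by rewrite mul0r.
by rewrite mulr0.
Qed.

Definition gbase : gring K.
Proof.
apply: (@Gring K K idfun base_hom) => //; last by move=> a _; exists a.
  by move=> e a b ha hb h; rewrite ha // hb // addr0.
exact: base_homM.
Defined.

Section Poly.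
Variable G : gring K.

Definition poly_hom e (p : {poly G}) :=
  forall i, if (i <= e)%N then ghom G (e - i) p`_i else p`_i = 0.

Lemma poly_homD e (a b : {poly G}) : poly_hom e a -> poly_hom e b -> poly_hom e (a + b).
Proof.
move=> ha hb i; move: (ha i) (hb i); rewrite coefD; case: ifP => _; first exact: ghomD.
by move=> -> ->; rewrite addr0.
Qed.

Lemma poly_homM e f (a b : {poly G}) :
  poly_hom e a -> poly_hom f b -> poly_hom (e + f) (a * b).
Proof.
move=> ha hb i; rewrite coefM.
have ab (j : 'I_i.+1) : (e < j)%N || (f < i - j)%N -> a`_j * b`_(i - j) = 0.
  case/orP => h; first by have := ha j; rewrite leqNgt h /= => ->; rewrite mul0r.
  by have := hb (i - j)%N; rewrite leqNgt h /= => ->; rewrite mulr0.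
case: ifP => hi; last first.
  by apply: big1 => j _; apply: ab; have := ltn_ord j; lia.
apply: ghom_sum => j _; case: (boolP ((e < j)%N || (f < i - j)%N)).
  by move/ab=> ->; apply: ghom0.
rewrite negb_or -!leqNgt => /andP[h1 h2].
have -> : (e + f - i = (e - j) + (f - (i - j)))%N by have := ltn_ord j; lia.
by have := ha j; have := hb (i - j)%N; rewrite h1 h2 => ? ?; apply: ghomM.
Qed.

Definition gpoly : gring K.
Proof.
apply: (@Gring K {poly G} (polyC \o gemb G : {rmorphism K -> {poly G}}) poly_hom).
- by move=> e i; rewrite coef0; case: ifP => // _; apply: ghom0.
- exact: poly_homD.
- exact: poly_homM.
- move=> c i /=; rewrite coefC; case: i => [|i] //=; exact: ghomC.
- move=> a ha; have [c hc] : exists c, a`_0 = gemb G c by apply: ghom_deg0; apply: (ha 0).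
  exists c; apply/polyP => -[|i] /=; rewrite coefC //=; exact: (ha i.+1).
Defined.

Lemma poly_homC e (a : G) : ghom G e a -> ghom gpoly e a%:P.
Proof.
move=> ha i; rewrite coefC; case: i => [|i] /=; first by rewrite subn0.
by case: ifP => // _; apply: ghom0.
Qed.

Lemma poly_homX : ghom gpoly 1 'X.
Proof.
move=> i; rewrite coefX; case: i => [|[|i]] //=; first exact: ghom0.
exact: ghom1.
Qed.

Lemma horner_hom e (p : {poly G}) (a : G) :
  ghom gpoly e p -> ghom G 1 a -> ghom G e p.[a].
Proof.
move=> hp ha; rewrite horner_coef; apply: ghom_sum => i _.
have := hp i; case: ifP => [ie h|_ ->]; last by rewrite mul0r; apply: ghom0.
by rewrite -(subnK ie); apply: ghomM => //; apply: ghomX.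
Qed.

(** Synthetic division by a monic linear factor determines the coefficients of the quotient from the
    top, and each step of the recursion respects degrees. *)
Lemma root_hom e (p : {poly G}) (a : G) :
  ghom gpoly e.+1 p -> ghom G 1 a -> p.[a] = 0 ->
  exists2 z : {poly G}, ghom gpoly e z & p = ('X - a%:P) * z.
Proof.
move=> hp ha /eqP/factor_theorem[z pz]; exists z; last by rewrite mulrC.
have rec i : z`_i = p`_i.+1 + a * z`_i.+1.
  by rewrite pz mulrBr coefB coefMX /= coefMC mulrC subrK.
suff: forall n i, (size z <= i + n)%N ->
    if (i <= e)%N then ghom G (e - i) z`_i else z`_i = 0.
  by move=> h i; apply: (h (size z)); rewrite leq_addl.
elim=> [|n IH] i.
  by rewrite addn0 => h; rewrite nth_default //; case: ifP => // _; apply: ghom0.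
rewrite addnS -addSn => /IH hz; rewrite rec; have := hp i.+1; rewrite ltnS subSS.
case: (leqP i e) => h hpi.
  move: hz; case: ifP => hi hz; last by rewrite hz mulr0 addr0.
  apply: ghomD => //; have -> : (e - i = 1 + (e - i.+1))%N by lia.
  exact: ghomM.
by move: hz; rewrite hpi ifF => [->|]; rewrite ?mulr0 ?addr0 //; apply/negbTE; lia.
Qed.

End Poly.
End GRingTheory.

(** * Links and chains carried by a complex *)

Section Chains.
Variables (T : finType).

Definition closed_complex (D : {set {set T}}) :=
  forall A B : {set T}, A \in D -> B \subset A -> B \in D.

Lemma linkP (D : {set {set T}}) (A B : {set T}) :
  reflect [/\ B \in D, [disjoint A & B] & A :|: B \in D] (B \in link D A).
Proof. by rewrite inE; apply: (iffP and3P). Qed.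

Lemma link1P (D : {set {set T}}) y (B : {set T}) : closed_complex D ->
  reflect (y \notin B /\ y |: B \in D) (B \in link D [set y]).
Proof.
move=> cD; apply: (iffP (linkP _ _ _)) => [[_]|[yB h]].
  by rewrite disjoints1.
by split; rewrite ?disjoints1 //; apply: cD h (subsetUr _ _).
Qed.

Lemma link_closed (D : {set {set T}}) A : closed_complex D -> closed_complex (link D A).
Proof.
move=> cD B C /linkP[BD dB AB] CB; apply/linkP; split.
- exact: cD BD CB.
- exact: disjointWr dB.
- by apply: cD AB _; apply: setUS.
Qed.

Lemma link_link (D : {set {set T}}) A B : closed_complex D -> B \in link D A ->
  link (link D A) B = link D (A :|: B).
Proof.
move=> cD /linkP[BD dB AB]; apply/setP => C; apply/linkP/linkP.
  case=> /linkP[CD dC AC] dBC /linkP[_ _ h]; split=> //; last by rewrite -setUA.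
  by rewrite -setI_eq0 setIUl setU_eq0 !setI_eq0 dC.
case=> CD; rewrite -setI_eq0 setIUl setU_eq0 !setI_eq0 => /andP[dAC dBC] h.
split=> //; apply/linkP; split=> //.
- by apply: cD h _; rewrite setSU // subsetUl.
- by apply: cD h _; rewrite setSU // subsetUr.
- by rewrite -setI_eq0 setIUr setU_eq0 !setI_eq0 dB.
- by rewrite setUA.
Qed.

Lemma link0 (D : {set {set T}}) : link D set0 = D.
Proof. by apply/setP => B; rewrite inE set0U -setI_eq0 set0I eqxx /= andbb. Qed.

Variable A : comNzRingType.
Implicit Types (u : chain T A).

Lemma ctr_carried (D : {set {set T}}) k y u : closed_complex D ->
  carried (faces D k.+1) u -> carried (faces (link D [set y]) k) (ctr y u).
Proof.
move=> cD hu B hB; rewrite ffunE; case: ifPn => // yB; rewrite hu ?mulr0 //.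
apply: contra hB => /facesP[h1 /eqP h2]; apply/facesP; split; first by apply/link1P.
by move: h2; rewrite cardsU1 yB add1n eqSS => /eqP.
Qed.

Lemma eps_carried (D : {set {set T}}) k y u : closed_complex D ->
  carried (faces (link D [set y]) k) u -> carried (faces D k.+1) (eps y u).
Proof.
move=> cD hu B hB; rewrite ffunE; case: ifPn => // yB; rewrite hu ?mulr0 //.
apply: contra hB => /facesP[/link1P-/(_ cD)[_]]; rewrite setD1K // => h1 h2.
by apply/facesP; split=> //; rewrite (cardsD1 y) yB h2.
Qed.

Lemma carriedD S u w : carried S u -> carried S w -> carried S (u + w).
Proof. by move=> hu hw B hB; rewrite ffunE hu // hw // addr0. Qed.

Lemma carriedN S u : carried S u -> carried S (- u).
Proof. by move=> hu B hB; rewrite ffunE hu // oppr0. Qed.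

Lemma carriedB S u w : carried S u -> carried S w -> carried S (u - w).
Proof. by move=> hu hw; apply: carriedD => //; apply: carriedN. Qed.

Lemma carriedS (S S' : {set {set T}}) u : S \subset S' -> carried S u -> carried S' u.
Proof. by move=> sS hu B hB; apply: hu; apply: contra hB; apply: (subsetP sS). Qed.

Lemma link_faces (D : {set {set T}}) k y : faces (link D [set y]) k \subset faces D k.
Proof. by apply/subsetP => B /facesP[/linkP[h _ _] <-]; apply/facesP. Qed.

Lemma eq_ct (l m : T -> A) u : l =1 m -> ct l u = ct m u.
Proof. by move=> lm; apply: eq_bigr => x _; rewrite lm. Qed.

End Chains.

Section ChainMap.
Variables (T : finType) (A A' : comNzRingType) (f : {rmorphism A -> A'}).

Definition cmap (u : chain T A) : chain T A' := [ffun B : {set T} => f (u B)].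

Lemma cmap_ct l u : cmap (ct l u) = ct (f \o l) (cmap u).
Proof.
apply/ffunP => B; rewrite ffunE !ctE rmorph_sum; apply: eq_bigr => x _.
by rewrite ffunE !rmorphM /sg rmorph_sign.
Qed.

End ChainMap.

(** * Koszul exactness over polynomial rings *)

Section Koszul.
Variables (F K : fieldType) (iota : {rmorphism F -> K}) (T : finType).
Implicit Types (D : {set {set T}}) (ls : nat -> T -> K).

Fixpoint gpow m : gring K := if m is m'.+1 then gpoly (gpow m') else gbase K.

Fixpoint gvar m : nat -> gpow m :=
  match m return nat -> gpow m with
  | 0 => fun _ => 0
  | m'.+1 => fun i => if i is i'.+1 then (gvar m' i')%:P else 'X
  end.

(** Contraction by [lam] is the sum of the contractions by [ls i], each multiplied by its own
    variable: one cycle condition over the polynomial ring encodes m of them over K. *)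
Definition lam m ls x : gpow m := \sum_(i < m) gemb (gpow m) (ls i x) * gvar m i.

Lemma gvar_hom m i : ghom (gpow m) 1 (gvar m i).
Proof.
elim: m i => [|m IH] [|i] //=; first exact: poly_homX.
exact: poly_homC.
Qed.

Lemma lam_hom m ls x : ghom (gpow m) 1 (lam m ls x).
Proof. by apply: ghom_sum => i _; apply: ghomZ; apply: gvar_hom. Qed.

Lemma gvar_free m (c : nat -> K) :
  \sum_(i < m) gemb (gpow m) (c i) * gvar m i = 0 -> forall i, (i < m)%N -> c i = 0.
Proof.
elim: m c => [|m IH] c //; rewrite big_ord_recl /= => h.
have h2 : \sum_(i < m) (gemb (gpow m) (c (lift ord0 i)))%:P * (gvar m i)%:P =
   (\sum_(i < m) gemb (gpow m) (c i.+1) * gvar m i)%:P.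
  by rewrite rmorph_sum; apply: eq_bigr => i _; rewrite -polyCM.
rewrite h2 in h; case=> [_|i].
  move/(congr1 (fun p : {poly _} => p`_1)): h.
  rewrite coefD coefCM coefX coefC coef0 /= mulr1 addr0 => /eqP.
  by rewrite fmorph_eq0 => /eqP.
rewrite ltnS; apply: (IH (fun i => c i.+1)).
move/(congr1 (fun p : {poly _} => p`_0)): h.
by rewrite coefD coefCM coefX coefC coef0 /= mulr0 add0r.
Qed.

(** One step of Gaussian elimination with pivot [ls 0 y]: the remaining functionals are made to
    vanish at y, and are used on the link of y. *)
Definition project y ls : nat -> T -> K :=
  fun i x => ls i.+1 x - ls i.+1 y / ls 0%N y * ls 0%N x.

(** General position of the functionals on D as nonvanishing of all pivots, in the recursive form
    that suits an induction through links. *)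
Fixpoint nondeg m D ls : Prop :=
  if m is m'.+1 then
    forall y, [set y] \in D -> ls 0%N y != 0 /\ nondeg m' (link D [set y]) (project y ls)
  else True.

(** The value of the outermost variable at which the form of y vanishes; evaluation there is
    reduction modulo that form and yields the forms of the projected functionals. *)
Definition lam0 m y ls : gpow m :=
  - (gemb (gpow m) (ls 0%N y)^-1 * lam m (fun i => ls i.+1) y).

Lemma lamS m ls x :
  lam m.+1 ls x = (gemb (gpow m) (ls 0%N x))%:P * 'X + (lam m (fun i => ls i.+1) x)%:P.
Proof.
rewrite /lam big_ord_recl /=; congr (_ + _); rewrite rmorph_sum.
by apply: eq_bigr => i _; rewrite -polyCM.
Qed.

Lemma lamS_root m ls y : ls 0%N y != 0 ->
  lam m.+1 ls y = (gemb (gpow m) (ls 0%N y))%:P * ('X - (lam0 m y ls)%:P).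
Proof.
move=> y0; rewrite lamS mulrBr; congr (_ + _); rewrite -polyCM -polyCN; congr (_%:P).
by rewrite mulrN opprK mulrA -rmorphM divff // rmorph1 mul1r.
Qed.

Lemma lamS_eval m ls x y : (lam m.+1 ls x).[lam0 m y ls] = lam m (project y ls) x.
Proof.
rewrite lamS hornerD hornerCM hornerX hornerC /lam0 mulrN mulrA -rmorphM addrC.
rewrite /lam mulr_sumr -sumrB; apply: eq_bigr => i _.
rewrite mulrA -mulrBl -rmorphM -rmorphB; congr (gemb _ _ * _).
by rewrite /project mulrC mulrA mulrAC.
Qed.

Definition wts (G : gring K) (W : {set T}) (l : T -> G) x : G := if x \in W then l x else 1.

(** Interpolates between simplicial homology (W empty) and the Koszul statement (W full). The
    degrees are chosen so that the weighted contraction preserves them; for W full, u has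
    coefficients of degree 1 and w has constants. *)
Definition exact_at (G : gring K) D (l : T -> G) (W : {set T}) b :=
  forall u : chain T G, carried (faces D b) u ->
    (forall X, ghom G (b.+1 - #|X :&: W|) (u X)) -> ct (wts W l) u = 0 ->
    exists w : chain T G, [/\ carried (faces D b.+1) w,
      forall X, ghom G (b.+1 - #|X :&: W|) (w X) & ct (wts W l) w = u].

Definition vanish_links D m b :=
  forall A, A \in D -> (#|A| < m)%N -> rhom_vanish F (link D A) b.

Lemma vanish_links_link D m b y : closed_complex D -> [set y] \in D ->
  vanish_links D m.+1 b -> vanish_links (link D [set y]) m b.
Proof.
move=> cD yD h A AD Am; rewrite link_link //.
case/link1P: AD => // yA yAD; apply: h => //.
by rewrite cardsU1 yA.
Qed.

Lemma exact_at0 (G : gring K) D (l : T -> G) b : rhom_vanish F D b -> exact_at D l set0 b.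
Proof.
move=> /rhom_vanish_algebra[s hs] u hu homu cu.
have eu w : ct (wts set0 l) w = ct (fun=> 1) w.
  by apply: eq_ct => x; rewrite /wts inE.
rewrite eu in cu.
have [h1 h2] := hs G (gemb G \o iota : {rmorphism F -> G}) u hu cu.
eexists; split; [exact: h1 | | by rewrite eu].
move=> X; rewrite ffunE; apply: ghom_sum => Y _; apply: ghomZ.
by have := homu Y; rewrite !setI0.
Qed.

(* Passing from [W :\ y] to [W] replaces the weight 1 of [y] by the linear form [lam y]. A
   primitive for the first operator is corrected by a boundary so that its part containing [y]
   becomes divisible by [lam y]; this is possible because modulo [lam y] that part is a cycle
   in the link of [y], with one variable fewer. *)
Lemma exact_atS m D ls W b : closed_complex D -> nondeg m.+1 D ls ->
  rhom_vanish F D b ->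
  (forall y W', [set y] \in D -> exact_at (link D [set y]) (lam m (project y ls)) W' b) ->
  exact_at D (lam m.+1 ls) W b.
Proof.
move=> cD nd rv IH.
have [n] := ubnP #|W|; elim: n W => // n IHn W hW.
case: (set_0Vmem W) => [->|[y yW]]; first exact: exact_at0.
pose W' := W :\ y.
have yW' : y \notin W' by rewrite !inE eqxx.
have IHW : exact_at D (lam m.+1 ls) W' b.
  by apply: IHn; move: hW; rewrite (cardsD1 y) yW.
set G := gpow m.+1; set l := lam m.+1 ls.
have wtsW x : x != y -> wts W l x = wts W' l x by move=> xy; rewrite /wts !inE xy.
(* If y is not a vertex, the two weightings act alike on chains of D. *)
case: (boolP ([set y] \in D)) => yD; last first.
  have yX k X : X \in faces D k -> y \notin X.
    by move=> /facesP[XD _]; apply: contra yD => yX; apply: cD XD _; rewrite sub1set.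
  have ctW k (u : chain T G) : carried (faces D k) u -> ct (wts W l) u = ct (wts W' l) u.
    move=> hu; apply/ffunP => B; rewrite !ctE; apply: eq_bigr => x _.
    case: (eqVneq x y) => [->|xy]; last by rewrite wtsW.
    by rewrite hu ?mulr0 //; apply/negP => /yX; rewrite setU11.
  have cardW k (u : chain T G) e X : carried (faces D k) u ->
      (ghom G (e - #|X :&: W|) (u X) <-> ghom G (e - #|X :&: W'|) (u X)).
    move=> hu; case: (boolP (X \in faces D k)) => [/yX yX'|/hu->]; last first.
      by split=> _; apply: ghom0.
    suff -> : X :&: W = X :&: W' by [].
    by apply/setP => z; rewrite !inE; case: (eqVneq z y) => // ->; rewrite (negbTE yX').
  move=> u hu homu; rewrite (ctW _ _ hu) => cu.
  have [|w [hw homw cw]] := IHW u hu _ cu; first by move=> X; apply/(cardW _ _ _ _ hu).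
  exists w; split=> //; first by move=> X; apply/(cardW _ _ _ _ hw).
  by rewrite (ctW _ _ hw).
have [y0 ndy] := nd y yD.
have ly0 : l y != 0.
  by rewrite /l lamS_root // mulf_neq0 ?polyXsubC_eq0 // polyC_eq0 fmorph_eq0.
pose a := lam0 m y ls.
have ha : ghom (gpow m) 1 a.
  by apply: ghomN; apply: ghomZ; apply: lam_hom.
pose ev : {rmorphism {poly gpow m} -> gpow m} := horner_eval a.
have evW x : ev (wts W' l x) = wts W' (lam m (project y ls)) x.
  rewrite /wts; case: ifP => _; last by rewrite rmorph1.
  exact: lamS_eval.
have ewt : ev \o wts W' l =1 wts W' (lam m (project y ls)) by move=> x; apply: evW.
(* Scaling the faces that contain y by [l y] intertwines the two weighted contractions; the aim is a
   primitive of [mult u] in the image of [mult]. *)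
pose mult (w : chain T G) : chain T G := [ffun X : {set T} => if y \in X then l y * w X else w X].
have ct_mult w : ct (wts W' l) (mult w) = mult (ct (wts W l) w).
  apply/ffunP => B; rewrite [RHS]ffunE !ctE; case: ifPn => yB.
    rewrite mulr_sumr; apply: eq_bigr => x; rewrite inE => xB.
    rewrite ffunE !inE yB orbT mulrCA wtsW //; by apply: contraNneq xB => ->.
  apply: eq_bigr => x; rewrite inE => xB; rewrite ffunE !inE (negbTE yB) orbF.
  case: (eqVneq y x) => [<-|xy]; last by rewrite wtsW // eq_sym.
  by rewrite /wts (negbTE yW') yW mulr1 mulrA.
have mult_inj : injective mult.
  move=> w w' /ffunP e; apply/ffunP => X; move: (e X); rewrite !ffunE.
  by case: ifP => // _; apply: mulfI.
move=> u hu homu cu.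
have hu' : carried (faces D b) (mult u).
  by move=> X hX; rewrite ffunE hu // mulr0 if_same.
have cardXy (X : {set T}) : y \in X -> #|X :&: W| = #|X :&: W'|.+1.
  move=> yX; rewrite (cardsD1 y) inE yX yW add1n; congr _.+1; apply: eq_card => z.
  by rewrite !inE andbCA.
have cardXn (X : {set T}) : y \notin X -> X :&: W = X :&: W'.
  move=> yX; apply/setP => z; rewrite !inE; case: (eqVneq z y) => // ->.
  by rewrite (negbTE yX).
have cardb k X : X \in faces D k -> (#|X :&: W| <= k)%N.
  by move=> /facesP[_ <-]; rewrite subset_leq_card // subsetIl.
have homu' X : ghom G (b.+1 - #|X :&: W'|) (mult u X).
  case: (boolP (X \in faces D b)) => [hX|/hu'->]; last exact: ghom0.
  rewrite ffunE; case: ifPn => yX; last by rewrite -cardXn.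
  have -> : (b.+1 - #|X :&: W'| = 1 + (b.+1 - #|X :&: W|))%N.
    by have := cardb _ _ hX; rewrite cardXy //; lia.
  by apply: ghomM => //; apply: lam_hom.
have [|w0 [hw0 homw0 cw0]] := IHW _ hu' homu'.
  by rewrite ct_mult cu; apply/ffunP => X; rewrite !ffunE mulr0 if_same.
(* This is the part to be made divisible by [l y]. Its boundary is a multiple of [l y], hence 0
   after evaluation, and exactness in the link applies. *)
pose w1 := ctr y w0.
have hw1 : carried (faces (link D [set y]) b) w1 by apply: ctr_carried.
have homw1 X : ghom G (b.+1 - #|X :&: W'|) (w1 X).
  rewrite ffunE; case: ifPn => yX; first exact: ghom0.
  apply: ghom_sign; have := homw0 (y |: X).
  suff -> : (y |: X) :&: W' = X :&: W' by [].
  by apply/setP => z; rewrite !inE; case: (eqVneq z y) => //= _; rewrite andbF.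
have cw1 : ct (wts W' l) w1 = - (l y *: ctr y u).
  rewrite ct_ctr cw0; congr (- _); apply/ffunP => X; rewrite chainZE !ffunE.
  by case: ifP => _; rewrite ?mulr0 // setU11 mulrCA.
have [|||q [hq homq cq]] := IH y W' yD (cmap ev w1).
- by move=> X hX; rewrite ffunE hw1 // rmorph0.
- move=> X; rewrite ffunE; apply: horner_hom => //; exact: homw1.
- have -> : ct (wts W' (lam m (project y ls))) (cmap ev w1) = cmap ev (ct (wts W' l) w1).
    by rewrite cmap_ct (eq_ct _ ewt).
  rewrite cw1; apply/ffunP => X; rewrite [LHS]ffunE [X in ev X]ffunE chainZE rmorphN rmorphM.
  rewrite [ev (l y)](_ : _ = 0) ?mul0r ?oppr0 ?ffunE //.
  have -> : ev (l y) = lam m (project y ls) y by apply: lamS_eval.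
  by apply: big1 => i _; rewrite /project divfK // subrr rmorph0 mul0r.
pose q' : chain T G := cmap polyC q.
have hq' : carried (faces (link D [set y]) b.+1) q'.
  by move=> X hX; rewrite ffunE hq // rmorph0.
have homq' X : ghom G (b.+1 - #|X :&: W'|) (q' X).
  by rewrite ffunE; apply: poly_homC.
pose e := w1 - ct (wts W' l) q'.
have he : carried (faces (link D [set y]) b) e.
  apply: carriedB => // X hX; rewrite ctE big1 // => x; rewrite inE => xX.
  rewrite hq' ?mulr0 //; apply: contra hX => /facesP[h1 /eqP h2]; apply/facesP.
  split; first by apply: (link_closed cD h1); apply: subsetUr.
  by move: h2; rewrite cardsU1 xX eqSS => /eqP.
have exz X : exists z : G, ghom G (b - #|X :&: W'|) z /\ e X = l y * z /\
   (X \notin faces (link D [set y]) b -> z = 0).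
  case: (boolP (X \in _)) => [hX|/he->]; last first.
    by exists 0; rewrite mulr0; split; first exact: ghom0.
  have leX : (#|X :&: W'| <= b)%N.
    by move/facesP: hX => [_ <-]; rewrite subset_leq_card // subsetIl.
  have [|||z hz ez] := @root_hom K (gpow m) (b - #|X :&: W'|) (e X) a.
  - rewrite -subSn //; have -> : e X = w1 X - ct (wts W' l) q' X.
      by rewrite [LHS]ffunE [X in _ + X]ffunE.
    apply: (@ghomB K G); first exact: homw1.
    rewrite ctE; apply: (@ghom_sum K G) => x; rewrite inE => xX.
    rewrite -mulrA; apply: (@ghom_sign K G); have := homq' (x |: X); rewrite /wts.
    case: ifPn => xW' hx.
      have -> : (b.+1 - #|X :&: W'| = 1 + (b.+1 - #|(x |: X) :&: W'|))%N.
        have -> : (x |: X) :&: W' = x |: (X :&: W').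
          by apply/setP => z; rewrite !inE; case: (eqVneq z x) => //= ->; rewrite -in_setD1 xW'.
        by rewrite cardsU1 inE (negbTE xX) /=; lia.
      by apply: ghomM => //; apply: lam_hom.
    suff <- : (x |: X) :&: W' = X :&: W' by rewrite mul1r.
    apply/setP => z; rewrite -/W' !in_setI !in_setU1; case: (eqVneq z x) => //= ->.
    by rewrite (negbTE xW') andbF.
  - exact: ha.
  - rewrite -/(horner_eval a (e X)) -/(ev (e X)).
    have -> : ev (e X) = cmap ev e X by rewrite [RHS]ffunE.
    have -> : cmap ev e = cmap ev w1 - cmap ev (ct (wts W' l) q').
      by apply/ffunP => Y; rewrite !ffunE rmorphB.
    rewrite cmap_ct -cq.
    have -> : cmap ev q' = q.
      by apply/ffunP => Y; rewrite ffunE [q' Y]ffunE; apply: hornerC.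
    by rewrite (eq_ct _ ewt) subrr ffunE.
  exists ((gemb (gpow m) (ls 0%N y)^-1)%:P * z); split; last split.
  - by apply: ghomZ.
  - rewrite ez /l lamS_root // mulrACA -polyCM -rmorphM divff // rmorph1 mul1r.
    by rewrite mulrC.
  - by [].
have /fin_all_exists[z hz] := exz.
pose zc : chain T G := finfun z.
have hzc : carried (faces (link D [set y]) b) zc.
  by move=> X hX; rewrite ffunE (hz X).2.2.
(* The preimage under [mult] of [w0] plus the boundary of [eps y q']: the part of that sum
   containing y is [eps y e], and [zc] is [e] divided by [l y]. *)
pose w := eps y zc + ((w0 - eps y w1) + q').
have mult_w : mult w = w0 + ct (wts W' l) (eps y q').
  rewrite ct_eps /wts (negbTE yW') scale1r.
  have -> : mult w = l y *: eps y zc + (w0 - eps y w1 + q').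
    apply/ffunP => X; rewrite [RHS]ffunE chainZE ffunE [w X]ffunE; case: ifPn => yX.
      rewrite mulrDr; congr (_ + _).
      suff -> : (w0 - eps y w1 + q') X = 0 by rewrite mulr0.
      rewrite !ffunE yX !inE eqxx /= mulrA setD1K // sgD1 sg_sqr mul1r subrr add0r.
      by rewrite hq ?rmorph0 //; apply/negP => /facesP[/link1P-/(_ cD)[]]; rewrite yX.
    by rewrite [eps y zc X]ffunE (negbTE yX) mulr0.
  have -> : l y *: eps y zc = eps y e.
    rewrite -linearZ /=; congr (eps y _); apply/ffunP => X; rewrite chainZE ffunE.
    by rewrite (hz X).2.1.
  rewrite linearB /= addrA [X in X + q']addrC addrA subrK.
  by rewrite -addrA [X in _ + X]addrC.
exists w; split.
- apply: carriedD; first exact: eps_carried.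
  apply: carriedD; last by apply: carriedS hq'; apply: link_faces.
  by apply: carriedB => //; apply: eps_carried.
- move=> X; rewrite ffunE; apply: ghomD.
    rewrite ffunE; case: ifPn => yX; last exact: ghom0.
    apply: ghom_sign; rewrite ffunE cardXy // subSS.
    suff -> : X :&: W' = (X :\ y) :&: W' by have [] := hz (X :\ y).
    by apply/setP => t; rewrite !inE; case: (eqVneq t y); rewrite ?andbF.
  rewrite !ffunE; case: ifPn => yX.
    rewrite !inE eqxx /= mulrA setD1K // sgD1 sg_sqr mul1r subrr add0r.
    rewrite hq ?rmorph0; first exact: (@ghom0 K G).
    by apply/negP => /facesP[/link1P-/(_ cD)[]]; rewrite yX.
  rewrite subr0 cardXn //; apply: ghomD; first exact: homw0.
  by have := homq' X; rewrite ffunE.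
- apply: mult_inj; rewrite -ct_mult mult_w linearD /= cw0.
  by rewrite ct_sqr addr0.
Qed.

End Koszul.

(** * Common primitives and a determinant criterion *)

Section KoszulExact.
Variables (F K : fieldType) (iota : {rmorphism F -> K}) (T : finType).
Implicit Types (D : {set {set T}}) (ls : nat -> T -> K).

Lemma koszul_exact m D ls W b : closed_complex D -> set0 \in D ->
  nondeg m D ls -> vanish_links F D m b -> exact_at D (lam m ls) W b.
Proof.
elim: m D ls W => [|m IH] D ls W cD D0 nd vl.
  (* No variables are left: the degree [b.+1 - #|X :&: W|] is positive on b-faces, so u is 0. *)
  move=> u hu homu _; exists 0; split; first by move=> X _; rewrite ffunE.
    by move=> X; rewrite ffunE => _.
  rewrite linear0; apply/ffunP => X; rewrite ffunE; apply/esym.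
  case: (boolP (X \in faces D b)) => [/facesP[_ hX]|/hu //]; apply: (homu X).
  by rewrite subn_gt0 ltnS -hX subset_leq_card // subsetIl.
apply: (exact_atS iota) => //.
  by have := vl set0 D0; rewrite cards0 link0; apply.
move=> y W' yD; apply: IH; [exact: link_closed | | exact: (nd y yD).2 |].
  by apply/link1P; rewrite // inE setU0.
exact: vanish_links_link.
Qed.

(* Exactness is applied to [y_i0 u]; in degree 0 a primitive has constant coefficients. *)
Lemma kill_exact m D ls b (u : chain T K) : closed_complex D -> set0 \in D ->
  nondeg m D ls -> vanish_links F D m b -> carried (faces D b) u ->
  (forall i, (i < m)%N -> ct (ls i) u = 0) -> forall i0, (i0 < m)%N ->
  exists w : chain T K, [/\ carried (faces D b.+1) w, ct (ls i0) w = u &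
    forall i, (i < m)%N -> i != i0 -> ct (ls i) w = 0].
Proof.
move=> cD D0 nd vl hu hk i0 i0m.
pose G := gpow K m; pose Y := @gvar K m.
pose em := cmap (gemb G).
have ct_em (w : chain T K) B :
    ct (wts setT (lam m ls)) (em T w) B = \sum_(i < m) gemb G (ct (ls i) w B) * Y i.
  transitivity (\sum_(i < m) \sum_(x in ~: B)
      sg G B x * (gemb G (ls i x) * Y i) * gemb G (w (x |: B))).
    rewrite ctE exchange_big; apply: eq_bigr => x _.
    by rewrite /wts inE /lam mulr_sumr mulr_suml; apply: eq_bigr => i _; rewrite ffunE.
  apply: eq_bigr => i _; rewrite ctE rmorph_sum mulr_suml; apply: eq_bigr => x _.
  by rewrite !rmorphM /sg rmorph_sign mulrA mulrAC.
pose u' : chain T G := Y i0 *: em T u.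
have [|||w [hw homw cw]] := @koszul_exact m D ls setT b cD D0 nd vl u'.
- by move=> X hX; rewrite chainZE ffunE hu // rmorph0 mulr0.
- move=> X; rewrite setIT chainZE ffunE.
  case: (boolP (X \in faces D b)) => [/facesP[_ ->]|/hu ->]; last first.
    by rewrite rmorph0 mulr0; apply: ghom0.
  rewrite subSnn -[1%N]addn0; apply: ghomM; first exact: gvar_hom.
  exact: ghomC.
- rewrite linearZ /=; apply/ffunP => X; rewrite chainZE ct_em big1 ?mulr0 ?ffunE //.
  by move=> i _; rewrite hk // ffunE rmorph0 mul0r.
have /fin_all_exists[w0 hw0] X : exists c, w X = gemb G c /\ (X \notin faces D b.+1 -> c = 0).
  case: (boolP (X \in faces D b.+1)) => [hX|/hw->]; last by exists 0; rewrite rmorph0.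
  have [c hc] : exists c, w X = gemb G c.
    by apply: ghom_deg0; have := homw X; rewrite setIT; have /facesP[_ ->] := hX; rewrite subnn.
  by exists c.
have ew : w = em T (finfun w0) by apply/ffunP => X; rewrite !ffunE (hw0 X).1.
have key i B : (i < m)%N -> ct (ls i) (finfun w0 : chain T K) B = (i == i0)%:R * u B.
  move: i; suff h : forall i, (i < m)%N ->
    ct (ls i) (finfun w0 : chain T K) B - (i == i0)%:R * u B = 0.
    by move=> i /h /eqP; rewrite subr_eq0 => /eqP.
  apply: (@gvar_free K m).
  under eq_bigr => i _ do rewrite rmorphB mulrBl.
  rewrite sumrB -ct_em -ew cw chainZE ffunE (bigD1 (Ordinal i0m)) //= eqxx mul1r.
  rewrite big1 ?addr0; first by rewrite mulrC subrr.
  by move=> i; rewrite -val_eqE /= => /negbTE->; rewrite mul0r rmorph0 mul0r.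
exists (finfun w0); split.
- by move=> X hX; rewrite ffunE (hw0 X).2.
- by apply/ffunP => B; rewrite key // eqxx mul1r.
- by move=> i im /negbTE ii0; apply/ffunP => B; rewrite key // ii0 mul0r ffunE.
Qed.

Definition evec (A : comNzRingType) (X : {set T}) : chain T A :=
  [ffun B : {set T} => (B == X)%:R].

(** On the monomial of a set X of size p, the coordinate at [set0] is up to sign the determinant of
    the values of the first p functionals on X. *)
Fixpoint ctn p ls (u : chain T K) : chain T K :=
  if p is p'.+1 then ctn p' (fun i => ls i.+1) (ct (ls 0%N) u) else u.

Lemma ctn_is_linear p ls : linear (ctn p ls).
Proof. by elim: p ls => [|p IH] ls a u v //=; rewrite linearP IH. Qed.
HB.instance Definition _ p ls :=
  GRing.isLinear.Build K _ _ _ (ctn p ls) (ctn_is_linear p ls).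

(** A row operation: [ct l] anticommutes with the other contractions, so it still kills every
    intermediate chain. *)
Lemma ctn_shift p ls (c : nat -> K) l u : ct l u = 0 ->
  ctn p (fun i x => ls i x - c i * l x) u = ctn p ls u.
Proof.
elim: p ls c u => [|p IH] ls c u hu //=.
have e : ct (fun x => ls 0%N x - c 0%N * l x) u = ct (ls 0%N) u.
  transitivity (ct (ls 0%N) u - c 0%N *: ct l u); last by rewrite hu scaler0 subr0.
  rewrite /ct scaler_sumr -sumrB; apply: eq_bigr => x _.
  by rewrite scalerBl scalerA.
by rewrite e IH // ct_ct hu linear0 oppr0.
Qed.

Lemma ctn_eps p ls y u : (forall i, ls i y = 0) ->
  ctn p ls (eps y u) = (-1) ^+ p *: eps y (ctn p ls u).
Proof.
elim: p ls u => [|p IH] ls u hy /=; first by rewrite scale1r.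
by rewrite ct_eps hy scale0r sub0r linearN /= IH // exprS mulN1r scaleNr.
Qed.

(** After contraction by [ls 0] the other functionals may be replaced by their projections, which
    vanish at y. Only the term with the pivot reaches [set0], so the determinant on [y |: X] is, up
    to sign, [ls 0 y] times that of the projections on X. *)
Lemma nondeg_ctn m D ls : closed_complex D ->
  (forall X, X \in D -> (#|X| <= m)%N -> ctn #|X| ls (evec K X) set0 != 0) -> nondeg m D ls.
Proof.
elim: m D ls => [|m IH] D ls cD h //= y yD.
have evU (X : {set T}) : y \notin X -> evec K (y |: X) = sg K X y *: eps y (evec K X).
  move=> yX; apply/ffunP => B; rewrite chainZE !ffunE.
  case: ifPn => yB; last first.
    rewrite mulr0; case: eqP => // e; by rewrite e setU11 in yB.
  rewrite -{1}(setD1K yB) (_ : (y |: B :\ y == y |: X) = (B :\ y == X)).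
    by case: eqP => [<-|_]; rewrite ?mulr0 // sgD1 mulrA sg_sqr mul1r.
  apply/eqP/eqP => [e|->//].
  by move/(congr1 (fun C : {set T} => C :\ y)): e; rewrite !setU1K // !inE eqxx.
have y0 : ls 0%N y != 0.
  have := h [set y] yD; rewrite cards1 /= => /(_ isT); apply: contraNneq => y0.
  have -> : [set y] = y |: set0 by rewrite setU0.
  rewrite evU ?inE // linearZ /= ct_eps y0 scale0r sub0r chainZE !ffunE.
  by rewrite inE oppr0 mulr0.
split=> //; apply: IH; first exact: link_closed.
move=> X /link1P-/(_ cD)[yX yXD] hX; have := h _ yXD.
rewrite cardsU1 yX add1n => /(_ hX); apply: contraNneq => h0 /=.
rewrite evU // !linearZ /= chainZE.
rewrite -(@ctn_shift _ _ (fun i => ls i.+1 y / ls 0%N y) (ls 0%N)) ?ct_sqr //.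
rewrite -/(project y ls) ct_eps linearB linearZ /= ctn_eps; last first.
  by move=> i; rewrite /project divfK // subrr.
rewrite [X in _ * X]ffunE chainZE h0 mulr0 add0r ffunE chainZE ffunE inE.
by rewrite mulr0 oppr0 mulr0.
Qed.

End KoszulExact.

(** * Purity of Cohen-Macaulay complexes *)

Section Pure.
Variables (F : fieldType) (T : finType).
Implicit Types (G D : {set {set T}}) (A B X Z : {set T}).

Lemma maxsize_ge G Z : Z \in G -> (#|Z| <= maxsize G)%N.
Proof. exact: (@leq_bigmax_cond _ (mem G) (fun B : {set T} => #|B|)). Qed.

Lemma maxsize_attained G : set0 \in G -> exists2 Z, Z \in G & #|Z| = maxsize G.
Proof.
move=> G0; have [|Z ZG eZ] := @eq_bigmax_cond _ (mem G) (fun B : {set T} => #|B|).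
  by rewrite (cardsD1 set0) G0.
by exists Z.
Qed.

Lemma cm_link G B : closed_complex G -> B \in G ->
  cohen_macaulay F G -> cohen_macaulay F (link G B).
Proof.
move=> cG BG cm A AL k; rewrite link_link //; apply: cm.
by case/linkP: AL.
Qed.

Lemma maxsize_link1 G x : closed_complex G -> [set x] \in G ->
  ((maxsize (link G [set x])).+1 <= maxsize G)%N.
Proof.
move=> cG xG; have [|Z ZL <-] := @maxsize_attained (link G [set x]).
  by apply/link1P; rewrite // inE setU0.
have [xZ h] := link1P _ _ cG ZL.
by have := maxsize_ge h; rewrite cardsU1 xZ.
Qed.

(* Reduced homology in degree 0 makes the vertices of full local dimension a union of
   components of the 1-skeleton, hence everything. *)
Lemma cm_link_maxsize G : closed_complex G -> set0 \in G -> cohen_macaulay F G ->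
  (forall x X, [set x] \in G -> X \in link G [set x] ->
     exists Z, [/\ Z \in link G [set x], X \subset Z & #|Z| = maxsize (link G [set x])]) ->
  forall x, [set x] \in G -> (maxsize (link G [set x])).+1 = maxsize G.
Proof.
move=> cG G0 cm IH p pG.
pose P := [set x | ([set x] \in G) && ((maxsize (link G [set x])).+1 == maxsize G)].
have [Z0 Z0G eZ0] := maxsize_attained G0.
have n0 : (0 < maxsize G)%N by have := maxsize_ge pG; rewrite cards1.
have [z zZ0] : exists z, z \in Z0 by apply/set0Pn; rewrite -card_gt0 eZ0.
have inP x Z : Z \in G -> x \in Z -> #|Z| = maxsize G -> x \in P.
  move=> ZG xZ eZ; have xG : [set x] \in G by apply: cG ZG _; rewrite sub1set.
  rewrite inE xG eqn_leq maxsize_link1 //= -eZ (cardsD1 x) xZ add1n ltnS.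
  by apply: maxsize_ge; apply/link1P; rewrite // setD1K // !inE eqxx.
have zP : z \in P by apply: inP zZ0 eZ0.
suff pP : p \in P by move: pP; rewrite inE => /andP[_ /eqP].
apply: contraT => pP.
(* Vanishing on single vertices is available only if G has an edge; without edges p is in P at
   once. *)
case: (ltnP 1 (maxsize G)) => n1; last first.
  move: pP; rewrite inE pG eqn_leq maxsize_link1 //=.
  by rewrite (leq_trans n1).
have edgeP x y : x \in P -> [set y; x] \in G -> y != x -> y \in P.
  move=> xP yxG yx; have xG : [set x] \in G by apply: cG yxG _; apply: subsetUr.
  have [|Z [ZL yZ eZ]] := IH x [set y] xG; first by apply/link1P; rewrite // inE eq_sym yx setUC.
  have [xZ xZG] := link1P _ _ cG ZL.
  apply: (inP _ (x |: Z) xZG); first by rewrite inE (subsetP yZ) ?inE ?eqxx // orbT.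
  by rewrite cardsU1 xZ eZ; move: xP; rewrite inE => /andP[_ /eqP].
pose c : chain T F := [ffun B : {set T} => (B == [set z])%:R - (B == [set p])%:R].
have zG : [set z] \in G by apply: cG Z0G _; rewrite sub1set.
have rv : rhom_vanish F G 1 by have := cm set0 G0; rewrite link0; apply.
have sg0 x : sg F set0 x = 1 by rewrite /sg eq_card0 ?expr0 // => y; rewrite !inE.
have [||d [/supportedP hd]] := rv c.
- apply/supportedP => B hB; rewrite ffunE.
  have nB w : [set w] \in G -> (B == [set w]) = false.
    by move=> wG; apply: contraNF hB => /eqP ->; apply/facesP; rewrite wG cards1.
  by rewrite !nB // subrr.
- rewrite bdE; apply/ffunP => B; rewrite ctE [RHS]ffunE.
  have eqs x w : x \notin B -> (x |: B == [set w]) = (B == set0) && (x == w).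
    move=> xB; apply/eqP/andP => [e|[/eqP-> /eqP->]]; last by rewrite setU0.
    have /set1P xw : x \in [set w] by rewrite -e setU11.
    rewrite xw eqxx; split=> //; apply/eqP/setP => y; rewrite inE; apply/negbTE/negP => yB.
    have /set1P yw : y \in [set w] by rewrite -e inE yB orbT.
    by rewrite xw -yw yB in xB.
  case: (eqVneq B set0) => [eB|B0]; last first.
    by apply: big1 => x; rewrite inE => xB; rewrite ffunE !eqs // (negbTE B0) subrr mulr0.
  rewrite {B}eB in eqs *.
  have s1 w : \sum_(x in ~: (set0 : {set T})) (x == w)%:R = 1 :> F.
    by rewrite (bigD1 w) ?inE //= eqxx big1 ?addr0 // => x /andP[_ /negbTE->].
  transitivity (\sum_(x in ~: (set0 : {set T})) ((x == z)%:R - (x == p)%:R) : F).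
    by apply: eq_bigr => x _; rewrite sg0 !mul1r ffunE !eqs ?inE // eqxx.
  by rewrite sumrB !s1 subrr.
rewrite bdE => bdd.
(* No edge leaves P, so the restriction of d to P has boundary z alone, whose augmentation is 1;
   this contradicts that the boundary squares to 0. *)
pose d' : chain T F := [ffun E : {set T} => if E \subset P then d E else 0].
have bd' x : ct (fun=> 1) d' [set x] = if x \in P then c [set x] else 0.
  rewrite ctE; case: ifPn => xP; last first.
    apply: big1 => y _; rewrite ffunE ifN ?mulr0 //.
    by apply: contra xP => /subsetP; apply; rewrite !inE eqxx orbT.
  rewrite -bdd ctE; apply: eq_bigr => y; rewrite !inE => yx; congr (_ * _).
  rewrite ffunE subUset !sub1set xP andbT; case: ifPn => // yP.
  apply/esym/hd; apply: contra yP => /facesP[yxG _]; exact: edgeP yxG yx.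
have := congr1 (fun v : chain T F => v set0) (ct_sqr (fun=> 1) d').
rewrite ctE [RHS]ffunE (bigD1 z) ?inE //= setU0 bd' zP big1 ?addr0; last first.
  move=> x /andP[_ xz]; rewrite setU0 bd'; case: ifP => xP; last by rewrite mulr0.
  rewrite ffunE !(inj_eq set1_inj) (negbTE xz) (_ : x == p = false) ?subrr ?mulr0 //.
  by apply: contraNF pP => /eqP <-.
rewrite sg0 !mul1r ffunE eqxx (inj_eq set1_inj) (_ : z == p = false).
  by move/eqP; rewrite subr0 oner_eq0.
by apply: contraNF pP => /eqP <-.
Qed.

(** Induction on the dimension: for x in X, the rest of X is extended in the link of x, whose
    largest faces have one vertex less than those of G. *)
Lemma cm_pure G X : closed_complex G -> cohen_macaulay F G -> X \in G ->
  exists Z, [/\ Z \in G, X \subset Z & #|Z| = maxsize G].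
Proof.
have [n] := ubnP (maxsize G); elim: n G X => // n IHn G X hn cG cm XG.
have G0 : set0 \in G by apply: cG XG (sub0set _).
case: (set_0Vmem X) => [->|[x xX]].
  by have [Z ZG eZ] := maxsize_attained G0; exists Z; rewrite sub0set.
have IH y Y : [set y] \in G -> Y \in link G [set y] ->
    exists Z, [/\ Z \in link G [set y], Y \subset Z & #|Z| = maxsize (link G [set y])].
  move=> yG; apply: IHn; [|exact: link_closed|exact: cm_link].
  by apply: leq_trans (maxsize_link1 cG yG) _; rewrite -ltnS.
have xG : [set x] \in G by apply: cG XG _; rewrite sub1set.
have [|Z [ZL sZ eZ]] := IH x (X :\ x) xG.
  by apply/link1P; rewrite // setD1K // !inE eqxx.
have [xZ xZG] := link1P _ _ cG ZL; exists (x |: Z); split=> //.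
  by rewrite -[X](setD1K xX) setUS.
by rewrite cardsU1 xZ eZ add1n cm_link_maxsize.
Qed.

End Pure.

(** * The exterior product and elementary automorphisms *)

Section Product.
Variables (T : finType) (A : comNzRingType).
Implicit Types (u w : chain T A) (B C X R : {set T}) (x y : T).

(** The sign of the shuffle sorting the vertices of X followed by those of R. *)
Definition sgs X R : A := \prod_(a in X) sg A R a.

Definition wedge u w : chain T A :=
  [ffun C : {set T} => \sum_(X : {set T} | X \subset C) sgs X (C :\: X) * u X * w (C :\: X)].

(** The grade involution; it absorbs the degree sign in the Leibniz rule for [ctr]. *)
Definition bar u : chain T A := [ffun X : {set T} => (-1) ^+ #|X| * u X].

Lemma sg_prod R x : sg A R x = \prod_(b in R) (-1) ^+ (enum_rank b < enum_rank x)%N.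
Proof.
rewrite prodrXr; congr (_ ^+ _).
by rewrite cardsE -sum1_card big_mkcondr; apply: eq_bigr => b _; case: ifP.
Qed.

Lemma sgU2 B R x : [disjoint B & R] -> sg A (B :|: R) x = sg A B x * sg A R x.
Proof.
by move=> d; rewrite !sg_prod -bigU //; apply: eq_bigl => z; rewrite !inE.
Qed.

Lemma sgsUl B C R : [disjoint B & C] -> sgs (B :|: C) R = sgs B R * sgs C R.
Proof. by move=> d; rewrite /sgs -bigU //; apply: eq_bigl => z; rewrite !inE. Qed.

Lemma sgs1 x R : sgs [set x] R = sg A R x.
Proof. by rewrite /sgs big_set1. Qed.

Lemma sgsU1r X R x : x \notin X -> x \notin R ->
  sgs X (x |: R) = (-1) ^+ #|X| * sg A X x * sgs X R.
Proof.
move=> xX xR; rewrite sg_prod -prodr_const -!big_split /=; apply: eq_bigr => a aX.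
rewrite sgU //; congr (_ * _).
have: enum_rank a != enum_rank x by rewrite (inj_eq enum_rank_inj); apply: contraNneq xX => <-.
rewrite -(inj_eq val_inj) /= neq_ltn => /orP[] h; rewrite h ltnNge (ltnW h) /=.
  by rewrite expr0 expr1 mulN1r opprK.
by rewrite expr0 expr1 mulr1.
Qed.

Lemma sgsU1l X R x : x \notin X -> sgs (x |: X) R = sg A R x * sgs X R.
Proof. by move=> xX; rewrite sgsUl ?sgs1 // disjoints1. Qed.

Lemma sum_sub_in (f : {set T} -> A) C x : x \in C ->
  \sum_(X : {set T} | (X \subset C) && (x \in X)) f X = \sum_(X : {set T} | X \subset C :\ x) f (x |: X).
Proof.
move=> xC; rewrite (reindex_onto (fun X => x |: X) (fun X => X :\ x)) /=; last first.
  by move=> X /andP[_ xX]; rewrite setD1K.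
apply: eq_bigl => X; rewrite setU11 andbT subUset sub1set xC /= subsetD1.
case: (boolP (x \in X)) => xX; last by rewrite setU1K // eqxx andbT.
rewrite andbF; apply/negbTE; apply/negP => /andP[_ /eqP e].
by rewrite -e !inE eqxx in xX.
Qed.

Lemma sum_sub_notin (f : {set T} -> A) C x :
  \sum_(X : {set T} | (X \subset C) && (x \notin X)) f X = \sum_(X : {set T} | X \subset C :\ x) f X.
Proof. by apply: eq_bigl => X; rewrite subsetD1. Qed.

Lemma sum_sub_split (f : {set T} -> A) C x : x \in C ->
  \sum_(X : {set T} | X \subset C) f X =
  \sum_(X : {set T} | X \subset C :\ x) f (x |: X) + \sum_(X : {set T} | X \subset C :\ x) f X.
Proof. by move=> xC; rewrite (bigID (fun X : {set T} => x \in X)) /= sum_sub_in // sum_sub_notin. Qed.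

Lemma sub_facts C x X : x \in C -> X \subset C :\ x ->
  [/\ x \notin X, C :\: (x |: X) = C :\ x :\: X, C :\: X = x |: (C :\ x :\: X),
      x \notin C :\ x :\: X & [disjoint X & C :\ x :\: X] /\ C :\ x = X :|: (C :\ x :\: X)].
Proof.
move=> xC sX; have xX : x \notin X by move: sX; rewrite subsetD1 => /andP[].
split=> //.
- by rewrite setDDl.
- apply/setP => z; rewrite !inE; case: (eqVneq z x) => [->|] //=.
  by rewrite xC xX.
- by rewrite !inE eqxx andbF.
- split; first by rewrite -setI_eq0; apply/eqP/setP => z; rewrite !inE; case: (z \in X).
  by rewrite -{1}(setID (C :\ x) X) (setIidPr sX).
Qed.

Lemma wedge_epsl x u w : wedge (eps x u) w = eps x (wedge u w).
Proof.
apply/ffunP => C; rewrite !ffunE; case: ifPn => xC; last first.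
  apply: big1 => X sX; rewrite ffunE ifN ?mulr0 ?mul0r //.
  by apply: contra xC; apply: (subsetP sX).
rewrite (sum_sub_split _ xC) [X in _ + X]big1 ?addr0; last first.
  by move=> X sX; have [xX _ _ _ _] := sub_facts xC sX; rewrite ffunE ifN ?mulr0 ?mul0r.
rewrite mulr_sumr; apply: eq_bigr => X sX.
have [xX -> _ xR [d e]] := sub_facts xC sX.
rewrite ffunE setU11 setU1K // sgU1 sgsU1l // -(sgD1 _ C) e sgU2 // setDUl setDv set0U.
rewrite (setDidPl _) 1?disjoint_sym //; ring.
Qed.

Lemma wedge_epsr x u w : wedge (bar u) (eps x w) = eps x (wedge u w).
Proof.
apply/ffunP => C; rewrite !ffunE; case: ifPn => xC; last first.
  apply: big1 => X sX; rewrite [eps _ _ _]ffunE ifN ?mulr0 //.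
  by apply: contra xC; apply: (subsetP (subsetDl _ _)).
rewrite (sum_sub_split _ xC) [X in X + _]big1 ?add0r; last first.
  by move=> X sX; rewrite [eps _ _ _]ffunE ifN ?mulr0 //; rewrite !inE eqxx.
rewrite mulr_sumr; apply: eq_bigr => X sX.
have [xX _ eR xR [d e]] := sub_facts xC sX; rewrite eR.
set R := C :\ x :\: X in eR xR d e *.
rewrite !ffunE setU11 setU1K // sgU1 sgsU1r // -(sgD1 _ C) e sgU2 //.
have := sqrr_sign A #|X|; set c := (-1) ^+ _ => c2.
transitivity (c ^+ 2 * (sg A X x * sgs X R * u X * (sg A R x * w R))); first ring.
by rewrite c2; ring.
Qed.

Lemma ctr_wedge x u w : ctr x (wedge u w) = wedge (ctr x u) w + wedge (bar u) (ctr x w).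
Proof.
apply/ffunP => C; rewrite [RHS]ffunE [LHS]ffunE; case: ifPn => xC.
  rewrite !ffunE !(sum_sub_split _ xC).
  rewrite [X in X + _ + _]big1 ?add0r; last first.
    by move=> X _; rewrite ffunE setU11 mulr0 mul0r.
  rewrite [X in _ + (_ + X)]big1 ?addr0; last first.
    move=> X sX; have [xX _ -> _ _] := sub_facts xC sX.
    by rewrite [ctr _ _ _]ffunE setU11 mulr0.
  apply/esym/eqP; rewrite -big_split /=; apply/eqP; apply: big1 => X sX.
  have [xX -> -> xR [d e]] := sub_facts xC sX; set R := C :\ x :\: X in xR d e *.
  rewrite !ffunE (negbTE xX) (negbTE xR) sgsU1r // sgsU1l // cardsU1 xX exprS.
  have := sg_sqr A X x; set sx := sg A X x => sx2.
  transitivity ((-1) ^+ #|X| * sgs X R * u (x |: X) * w (x |: R) * (sx * sx - sg A R x * sg A R x)).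
    by ring.
  by rewrite sx2 sg_sqr subrr mulr0.
have xxC : x \in x |: C by rewrite setU11.
rewrite [wedge u w _]ffunE (sum_sub_split _ xxC) mulrDr setU1K //; congr (_ + _);
  rewrite ffunE mulr_sumr; apply: eq_bigr => X; rewrite -{1}(setU1K xC) => sX;
  have [xX e1 e2 xR [d e]] := sub_facts xxC sX; rewrite ?e1 ?e2; move: e1 e2 xR d e;
  rewrite setU1K // => _ _ xR d e.
  rewrite ffunE (negbTE xX) sgsU1l //.
  rewrite {1}e sgU2 //; have := sg_sqr A (C :\: X) x; set r := sg A _ x => r2.
  transitivity (r * r * (sg A X x * sgs X (C :\: X) * u (x |: X) * w (C :\: X))); first ring.
  by rewrite r2; ring.
rewrite !ffunE (negbTE xR) sgsU1r // {1}e sgU2 //.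
have := sg_sqr A X x; set r := sg A X x => r2.
transitivity (r * r * ((-1) ^+ #|X| * sg A (C :\: X) x * sgs X (C :\: X) * u X * w (x |: (C :\: X)))); first ring.
by rewrite r2; ring.
Qed.

Lemma barK u : bar (bar u) = u.
Proof. by apply/ffunP => X; rewrite !ffunE mulrA -expr2 sqrr_sign mul1r. Qed.

Lemma wedgeDl u v w : wedge (u + v) w = wedge u w + wedge v w.
Proof.
apply/ffunP => C; rewrite !ffunE -big_split; apply: eq_bigr => X _ /=.
by rewrite ffunE mulrDr mulrDl.
Qed.

Lemma wedgeDr u v w : wedge u (v + w) = wedge u v + wedge u w.
Proof.
apply/ffunP => C; rewrite !ffunE -big_split; apply: eq_bigr => X _ /=.
by rewrite ffunE mulrDr.
Qed.

Lemma wedgeZl a u w : wedge (a *: u) w = a *: wedge u w.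
Proof.
apply/ffunP => C; rewrite chainZE !ffunE mulr_sumr; apply: eq_bigr => X _ /=.
by rewrite chainZE; ring.
Qed.

Lemma wedgeZr a u w : wedge u (a *: w) = a *: wedge u w.
Proof.
apply/ffunP => C; rewrite chainZE !ffunE mulr_sumr; apply: eq_bigr => X _ /=.
by rewrite chainZE; ring.
Qed.

(* The automorphism e_z |-> e_z + t e_j (other generators fixed) of the exterior algebra. *)
Definition move j z (t : A) u : chain T A := u + t *: eps j (ctr z u).

(** The terms linear in t agree because [ctr z] is an antiderivation; the quadratic term contains
    [eps j] twice. *)
Lemma wedge_move j z t u w : wedge (move j z t u) (move j z t w) = move j z t (wedge u w).
Proof.
rewrite /move !wedgeDl !wedgeDr !wedgeZl !wedgeZr.
have e (a b : chain T A) : wedge a (eps j b) = eps j (wedge (bar a) b).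
  by rewrite -{1}(barK a) wedge_epsr.
rewrite !wedge_epsl ctr_wedge linearD scalerDr -!addrA; congr (_ + _).
rewrite !e.
have -> : eps j (eps j (wedge (bar (ctr z u)) (ctr z w))) = 0.
  by apply/ffunP => C; rewrite !ffunE !inE eqxx mulr0 if_same.
rewrite !scaler0 addr0.
by rewrite addrC.
Qed.

End Product.

HB.instance Definition _ (T : finType) (K : fieldType) :=
  Vector.copy (chain T K) {ffun {set T} -> K^o}.


(** * Semicontinuity of rank *)

Section GenericRank.
Variables (K : fieldType) (V W : vectType K).

(** Preimages under f of a basis of the image are fixed. Their images under [f + t *: g], in
    coordinates along that basis, form the matrix [1 + t N]; its determinant is 1 at t = 0, and
    where it is nonzero these images are independent. *)
Lemma generic_dim_img (f g : 'Hom(V, W)) (Y : {vspace V}) :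
  exists2 P : {poly K}, P != 0 &
    forall t, P.[t] != 0 -> (\dim (f @: Y) <= \dim ((f + t *: g) @: Y))%N.
Proof.
set d := \dim _; pose X := vbasis (f @: Y).
have /fin_all_exists[y hy] (i : 'I_d) : exists y, y \in Y /\ X`_i = f y.
  have /memv_imgP[y yY ->] : X`_i \in (f @: Y)%VS by apply/vbasis_mem/mem_nth; rewrite size_tuple.
  by exists y.
pose N : 'M[K]_d := \matrix_(i, k) coord X k (g (y i)).
pose P := \det (1%:M + 'X *: map_mx polyC N).
have PE t : P.[t] = \det (1%:M + t *: N).
  rewrite -horner_evalE -det_map_mx; congr (\det _); apply/matrixP => i k.
  rewrite !mxE /= horner_evalE hornerD hornerM hornerX hornerC; congr (_ + _).
  by case: (i == k); rewrite ?mulr1n ?mulr0n hornerC.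
exists P => [|t].
  apply/eqP => P0; have := PE 0; rewrite P0 horner0 scale0r addr0 det1 => /esym/eqP.
  by rewrite oner_eq0.
rewrite PE => Pt.
pose z : d.-tuple W := [tuple (f + t *: g) (y i) | i < d].
have zE (i : 'I_d) : z`_i = (f + t *: g) (y i) by rewrite -tnth_nth tnth_mktuple.
have fX : free X by apply: (basis_free (vbasisP _)).
have fz : free z.
  apply/freeP => k hk i.
  pose kv : 'rV[K]_d := \row_i k i.
  have kM : kv *m (1%:M + t *: N) = 0.
    apply/rowP => c; have e := congr1 (coord X c) hk; rewrite linear0 linear_sum in e.
    rewrite [RHS]mxE; apply: etrans e; rewrite mxE; apply: eq_bigr => a _; rewrite zE linearZ /= add_lfunE scale_lfunE linearD linearZ /=.
    by rewrite !mxE -(hy a).2 coord_free // [c == a]eq_sym.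
  have u : (1%:M + t *: N) \in unitmx by rewrite unitmxE unitfE.
  have : kv = 0 by rewrite -[kv]mulmx1 -(mulmxV u) mulmxA kM mul0mx.
  by move/rowP/(_ i); rewrite !mxE.
have <- : \dim <<z>> = d by rewrite (eqP fz) size_tuple.
apply/dimvS/span_subvP => w /tnthP[i ->]; rewrite tnth_mktuple.
by apply: memv_img; have [] := hy i.
Qed.

End GenericRank.

(** * Leading monomials *)

Section Initial.
Variables (T : finType) (n : nat) (idx : T -> nat).
Hypothesis idx_inj : injective idx.
Hypothesis idx_lt : forall x, (idx x < n)%N.
Variable K : fieldType.
Notation wt := (wt n idx).
Notation chainK := (chain T K).
Implicit Types (A B C : {set T}) (u : chainK) (Y : {vspace chain T K}).

Definition cut M u : chainK := [ffun B : {set T} => if (M <= wt B)%N then u B else 0].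
Lemma cut_is_linear M : linear (cut M).
Proof.
move=> a u w; apply/ffunP => B; rewrite !(chainZE, ffunE); case: ifP => _ //.
by rewrite mulr0 addr0.
Qed.
HB.instance Definition _ M := GRing.isLinear.Build K chainK chainK _ (cut M) (cut_is_linear M).

Definition low M : {vspace chainK} := lker (linfun (cut M)).

Lemma lowP M u : reflect (forall B, (M <= wt B)%N -> u B = 0) (u \in low M).
Proof.
rewrite memv_ker lfunE /=; apply: (iffP eqP) => [/ffunP h B hB|h].
  by have := h B; rewrite !ffunE hB.
by apply/ffunP => B; rewrite !ffunE; case: ifP => // /h.
Qed.

Definition lead u A := u A != 0 /\ forall B, u B != 0 -> (wt B <= wt A)%N.

(** Phrased with subspaces to be a boolean condition; as weights are injective, an element
    separating the two subspaces has leading monomial A. *)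
Definition leads Y : {set {set T}} :=
  locked [set A : {set T} | ~~ (Y :&: low (wt A).+1 <= low (wt A))%VS].

Lemma leadsP Y A : reflect (exists2 u, u \in Y & lead u A) (A \in leads Y).
Proof.
rewrite /leads -lock in_set; have h := @subvPn K _ (Y :&: low (wt A).+1) (low (wt A)); apply: (iffP h) => -[u] {h}.
  rewrite memv_cap => /andP[uY /lowP ul] /lowP un; exists u => //.
  have leA B : u B != 0 -> (wt B <= wt A)%N.
    by move=> uB; rewrite leqNgt; apply: contra uB => /ul ->.
  split=> //; apply/eqP => uA; apply: un => B hB; apply/eqP; apply: contraT => uB.
  have eBA : wt B = wt A by apply/eqP; rewrite eqn_leq hB leA.
  by move: uB; rewrite (wt_inj idx_inj idx_lt eBA) uA eqxx.
move=> uY [uA h]; exists u.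
  rewrite memv_cap uY; apply/lowP => B hB; apply/eqP; apply: contraT => /h.
  by rewrite leqNgt hB.
by apply/lowP => /(_ A (leqnn _)) /eqP; rewrite (negbTE uA).
Qed.

Definition coef A u : K^o := u A.
Lemma coef_is_linear A : linear (coef A).
Proof. by move=> a u w; rewrite /coef ffunE chainZE. Qed.
HB.instance Definition _ A := GRing.isLinear.Build K chainK K^o _ (coef A) (coef_is_linear A).

(** Raising the threshold from M to M + 1 admits at most one more coordinate, that of the set of
    weight M, and the dimension grows exactly if this set is a lead. *)
Lemma dim_low Y M : \dim (Y :&: low M) = #|[set A in leads Y | (wt A < M)%N]|.
Proof.
elim: M => [|M IH].
  rewrite (_ : [set _ in _ | _] = set0) ?cards0; last by apply/setP => A; rewrite !inE andbF.
  apply/eqP; rewrite dimv_eq0 -subv0; apply/subvP => u; rewrite memv_cap => /andP[_ /lowP h].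
  by rewrite memv0; apply/eqP/ffunP => B; rewrite ffunE h.
case: (pickP [pred A | wt A == M]) => [A /= /eqP wA|noA]; last first.
  have -> : low M.+1 = low M.
    apply/vspaceP => u; apply/lowP/lowP => h B hB; apply: h; last exact: ltnW.
    by rewrite ltn_neqAle hB andbT eq_sym; have /= -> := noA B.
  rewrite IH; apply: eq_card => A; rewrite !in_set [in RHS]ltnS [in RHS]leq_eqVlt.
  by have /= -> := noA A.
pose f : 'Hom(chainK, K^o) := linfun (coef A).
have <- := limg_ker_dim f (Y :&: low M.+1).
have -> : (Y :&: low M.+1 :&: lker f = Y :&: low M)%VS.
  apply/vspaceP => u; rewrite !memv_cap [u \in lker f]memv_ker lfunE /= -andbA; congr (_ && _).
  apply/andP/lowP => [[/lowP h /eqP uA] B|h].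
    by rewrite leq_eqVlt => /orP[/eqP e|/h //]; rewrite (wt_inj idx_inj idx_lt (etrans wA e)) in uA.
  split; first by apply/lowP => B /ltnW /h.
  by rewrite /coef h // wA.
rewrite IH.
have -> : \dim (f @: (Y :&: low M.+1)) = (A \in leads Y).
  case: (boolP (A \in leads Y)) => [/leadsP[u uY [uA hu]]|hA]; last first.
    apply/eqP; rewrite dimv_eq0 -subv0; apply/subvP => _ /memv_imgP[u + ->].
    rewrite memv_cap memv0 lfunE /= => /andP[uY /lowP h]; apply: contraNT hA => uA.
    apply/leadsP; exists u => //; split=> // B; apply: contraR; rewrite -ltnNge wA => /h ->.
    exact: eqxx.
  apply/eqP; rewrite eqn_leq; apply/andP; split.
    by apply: leq_trans (dimvS (subvf _)) _; rewrite dimvf.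
  rewrite lt0n dimv_eq0 -subv0; apply/subvPn; exists (f u).
    apply: memv_img; rewrite memv_cap uY; apply/lowP => B; rewrite ltnNge -wA => hB.
    by apply/eqP; apply: contraR hB => /hu.
  by rewrite memv0 lfunE.
rewrite (cardsD1 A [set B in leads Y | (wt B < M.+1)%N]) inE wA ltnSn andbT addnC.
congr (_ + _)%N; apply: eq_card => B; rewrite [LHS]in_set [RHS]in_setD1 in_set ltnS.
rewrite [in RHS]leq_eqVlt -wA (inj_eq (wt_inj idx_inj idx_lt)).
by case: (eqVneq B A) => [->|] //=; rewrite ltnn andbF.
Qed.

Lemma wt_max A : (wt A <= wt setT)%N.
Proof.
have -> : wt setT = (wt A + wt (~: A))%N.
  by rewrite -wtU ?setUCr // -setI_eq0 setICr.
exact: leq_addr.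
Qed.

Lemma low_full : low (wt setT).+1 = fullv.
Proof.
apply/vspaceP => u; rewrite memvf; apply/lowP => B hB.
by have := wt_max B; rewrite leqNgt hB.
Qed.

Lemma card_leads Y : #|leads Y| = \dim Y.
Proof.
rewrite -[Y in RHS]capvf -low_full dim_low; apply: eq_card => A.
by rewrite [RHS]inE ltnS wt_max andbT.
Qed.

Lemma leads_sub Y Z : (Y <= Z)%VS -> leads Y \subset leads Z.
Proof.
move=> YZ; apply/subsetP => A /leadsP[u uY hu]; apply/leadsP; exists u => //.
exact: (subvP YZ).
Qed.

Lemma card_leads_ge Y M :
  #|[set A in leads Y | (M <= wt A)%N]| = \dim (linfun (cut M) @: Y).
Proof.
apply/eqP; rewrite -(eqn_add2l (\dim (Y :&: low M))) limg_ker_dim dim_low -card_leads.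
rewrite -(cardsID [set A | (wt A < M)%N] (leads Y)); apply/eqP; congr (_ + _)%N.
  by apply: eq_card => A; rewrite [RHS]in_setI !in_set.
by apply: eq_card => A; rewrite [RHS]in_setD !in_set -leqNgt andbC.
Qed.

Lemma move_is_linear j z t : linear (@move T K j z t).
Proof.
move=> a u w; rewrite /move.
have -> : eps j (ctr z (a *: u + w)) = a *: eps j (ctr z u) + eps j (ctr z w) by rewrite !linearP.
by rewrite !scalerDr addrACA !scalerA mulrC.
Qed.
HB.instance Definition _ j z t :=
  GRing.isLinear.Build K chainK chainK _ (@move T K j z t) (move_is_linear j z t).

(** Monomials heavier than A come only from the term in t, where exchanging z for j adds the same
    amount to every weight. *)
Lemma lead_move j z t u A : (idx j < idx z)%N -> t != 0 -> z \in A -> j \notin A ->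
  lead u A -> lead (move j z t u) (swap j z A).
Proof.
move=> jz t0 zA jA [uA hu].
have jnz : j != z by apply: contraTneq jz => ->; rewrite ltnn.
have mE B : move j z t u B = u B + t * (if j \in B then sg K B j *
     (if z \in B :\ j then 0 else sg K (B :\ j) z * u (z |: B :\ j)) else 0).
  by rewrite /move ffunE chainZE !ffunE.
have u0 B : (wt A < wt B)%N -> u B = 0.
  by move=> h; apply/eqP; apply: contraTT h => /hu; rewrite -leqNgt.
have lt := wt_swap_lt idx_lt jz zA jA.
split.
  rewrite mE u0 // add0r setU11 setU1K; last by rewrite !inE (negbTE jA) andbF.
  by rewrite !inE eqxx /= setD1K // !mulf_neq0 // /sg signr_eq0.
move=> B; rewrite leqNgt; apply: contra => hB; rewrite mE u0 ?add0r; last exact: ltn_trans hB.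
case: ifP => jB; last by rewrite mulr0.
case: ifPn => zB; rewrite ?mulr0 //; rewrite u0 ?mulr0 //.
have zB' : z \notin B by move: zB; rewrite !inE eq_sym jnz.
have := wt_swap n idx zA jA; have := wtD1 n idx jB.
by rewrite wtU1 //; lia.
Qed.

(* Ranks of truncations are lower semicontinuous in [t], so no count of leads above a given
   weight drops for generic [t]; a missing swap [swap j z A] becomes a lead as soon as
   [t != 0]. *)
Lemma move_improves j z Y : (idx j < idx z)%N -> exists2 P : {poly K}, P != 0 &
  forall t, P.[t] != 0 ->
    let Y' := (linfun (move j z t) @: Y)%VS in
    (total_weight n idx (leads Y) <= total_weight n idx (leads Y'))%N /\
    (~~ shift_closed j z (leads Y) -> (total_weight n idx (leads Y) < total_weight n idx (leads Y'))%N).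
Proof.
move=> jz.
pose N := wt setT.
have exP (M : 'I_N.+1) : exists P : {poly K}, P != 0 /\ forall t, P.[t] != 0 ->
   (\dim (linfun (cut M) @: Y) <= \dim (linfun (cut M) @: (linfun (move j z t) @: Y)))%N.
  pose g : 'Hom(chainK, chainK) := (linfun (cut M) \o linfun (eps j \o ctr z))%VF.
  have [P P0 hP] := generic_dim_img (linfun (cut M)) g Y.
  exists P; split=> // t /hP h; apply: leq_trans h _.
  suff -> : (linfun (cut M) + t *: g)%R = (linfun (cut M) \o linfun (move j z t))%VF.
    by rewrite limg_comp.
  apply/lfunP => u; rewrite add_lfunE scale_lfunE !comp_lfunE !lfunE /= /move.
  by rewrite linearD linearZ.
have /fin_all_exists[P hP] := exP.
(* The factor ['X] excludes t = 0, where the move is the identity. *)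
exists ('X * \prod_M P M).
  by rewrite mulf_neq0 ?polyX_eq0 //; apply/prodf_neq0 => M _; have [] := hP M.
move=> t; rewrite hornerM hornerX mulf_eq0 negb_or => /andP[t0 Pt] Y'.
have mono M :
   (#|[set A in leads Y | (M <= wt A)%N]| <= #|[set A in leads Y' | (M <= wt A)%N]|)%N.
  case: (leqP M N) => hM; last first.
    rewrite eq_card0 // => A; rewrite !inE; apply/negbTE; rewrite negb_and -ltnNge.
    by rewrite (leq_ltn_trans (wt_max A) hM) orbT.
  rewrite !card_leads_ge; apply: (hP (Ordinal (hM : (M < N.+1)%N))).2.
  by apply: contraNneq Pt => h0; rewrite horner_prod (bigD1 (Ordinal (hM : (M < N.+1)%N))) //= h0 mul0r.
rewrite !(@total_weightE _ _ _ _ N); try by move=> A _; apply: wt_max.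
split; first by apply: leq_sum => M _; apply: mono.
rewrite negb_forall_in => /existsP[A /andP[AY]]; rewrite !negb_imply => /andP[zA /andP[jA hA]].
set A' := swap j z A in hA.
have lt : (wt A < wt A')%N by apply: wt_swap_lt.
have A'N : (wt A' <= N)%N by apply: wt_max.
have wA'0 : (0 < wt A')%N by apply: leq_ltn_trans lt.
(* This layer collects the weights from [wt A'] on. It grows strictly: no count above [wt A'] drops,
   and the new lead [A'] is the only set of its weight. *)
have hM : ((wt A').-1 < N)%N by rewrite prednK.
rewrite (bigD1 (Ordinal hM)) //= [X in (_ < X)%N](bigD1 (Ordinal hM)) //= -addSn.
apply: leq_add; last by apply: leq_sum => M _; apply: mono.
rewrite prednK //.
have A'Y' : A' \in leads Y'.
  have /leadsP[u uY hu] := AY; apply/leadsP; exists (move j z t u); last exact: lead_move.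
  by rewrite -[move j z t u]lfunE; apply: memv_img.
rewrite [X in (_ < X)%N](cardsD1 A') inE A'Y' leqnn add1n ltnS.
have eqS (S : {set {set T}}) : [set B in S | (wt A' <= wt B)%N] :\ A' = [set B in S | (wt A' < wt B)%N].
  apply/setP => B; rewrite !inE [in RHS]ltn_neqAle [_ == wt B]eq_sym (inj_eq (wt_inj idx_inj idx_lt)).
  by case: (B \in S); rewrite ?andbF.
rewrite eqS; apply: leq_trans (mono (wt A').+1).
rewrite -(eqS (leads Y)) (setDidPl _) // disjoint_sym disjoints1.
by rewrite inE (negbTE hA).
Qed.

End Initial.

(** * Leads of contractions and products; coordinate subspaces *)

Section Leads.
Variables (T : finType) (n : nat) (idx : T -> nat).
Hypothesis idx_inj : injective idx.
Hypothesis idx_lt : forall x, (idx x < n)%N.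
Variable K : fieldType.
Notation wt := (wt n idx).
Notation chainK := (chain T K).
Notation lead := (@lead T n idx K).
Notation leads := (@leads T n idx K).
Implicit Types (A B C : {set T}) (S : {set {set T}}) (u w : chainK) (Y : {vspace chain T K}).

Lemma lead_ctr u A a : a \in A -> lead u A -> lead (ctr a u) (A :\ a).
Proof.
move=> aA [uA hu]; split.
  by rewrite ffunE !inE eqxx /= setD1K // mulf_neq0 // /sg signr_eq0.
move=> B; rewrite ffunE; case: ifPn => aB; rewrite ?eqxx //.
rewrite mulf_eq0 negb_or => /andP[_ /hu].
by rewrite wtU1 // (wtD1 n idx aA) leq_add2l.
Qed.

Lemma lead_eps u A a : a \notin A -> lead u A -> lead (eps a u) (a |: A).
Proof.
move=> aA [uA hu]; split.
  by rewrite ffunE setU11 setU1K // mulf_neq0 // /sg signr_eq0.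
move=> B; rewrite ffunE; case: ifPn => aB; rewrite ?eqxx //.
rewrite mulf_eq0 negb_or => /andP[_ /hu].
by rewrite wtU1 // (wtD1 n idx aB) leq_add2l.
Qed.

(** Weights add, so any other splitting of the union would have a part heavier than A or than B,
    where u or w vanishes; nothing cancels. *)
Lemma lead_wedge u w A B : [disjoint A & B] -> lead u A -> lead w B ->
  wedge u w (A :|: B) != 0.
Proof.
move=> dAB [uA hu] [wB hw]; rewrite ffunE (bigD1 A) ?subsetUl //=.
have eB : (A :|: B) :\: A = B by rewrite setDUl setDv set0U; apply/setDidPl; rewrite disjoint_sym.
rewrite eB big1 ?addr0.
  by rewrite !mulf_neq0 //; apply/prodf_neq0 => a _; rewrite /sg signr_eq0.
move=> X /andP[sX XA]; apply/eqP; apply: contraNT XA; rewrite !mulf_eq0 !negb_or.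
case/andP => /andP[_ /hu h1] /hw h2.
have e : (wt X + wt ((A :|: B) :\: X) = wt A + wt B)%N.
  rewrite -!wtU //; first by rewrite -{1}(setIidPr sX) setID.
  by rewrite -setI_eq0; apply/eqP/setP => z; rewrite !inE; case: (z \in X).
by apply/eqP/(wt_inj idx_inj idx_lt); lia.
Qed.

Definition offS (S : {set {set T}}) u : chainK := [ffun B : {set T} => if B \in S then 0 else u B].
Lemma offS_is_linear S : linear (offS S).
Proof.
move=> a u w; apply/ffunP => B; rewrite !(chainZE, ffunE); case: ifP => _ //.
by rewrite mulr0 addr0.
Qed.
HB.instance Definition _ S := GRing.isLinear.Build K chainK chainK _ (offS S) (offS_is_linear S).

Definition coords (S : {set {set T}}) : {vspace chainK} := lker (linfun (offS S)).

Lemma coordsP S u : reflect (carried S u) (u \in coords S).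
Proof.
rewrite memv_ker lfunE /=; apply: (iffP eqP) => [/ffunP h B hB|h].
  by have := h B; rewrite !ffunE (negbTE hB).
by apply/ffunP => B; rewrite !ffunE; case: ifPn => // /h.
Qed.

Lemma evecE (X B : {set T}) : evec K X B = (B == X)%:R.
Proof. by rewrite ffunE. Qed.

Lemma dim_coords S : \dim (coords S) = #|S|.
Proof.
rewrite -(card_leads idx_inj idx_lt); apply: eq_card => A; apply/(leadsP idx_inj idx_lt)/idP.
  move=> [u /coordsP hu [uA _]]; by apply: contraNT uA => /hu ->.
move=> AS; exists (evec K A).
  by apply/coordsP => B hB; rewrite evecE; case: eqP hB => // ->; rewrite AS.
split; first by rewrite evecE eqxx oner_eq0.
by move=> B; rewrite evecE; case: (eqVneq B A) => [->|]; rewrite ?eqxx.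
Qed.

Lemma wedge_coords (S1 S2 : {set {set T}}) u w : cross_intersecting S1 S2 ->
  u \in coords S1 -> w \in coords S2 -> wedge u w = 0.
Proof.
move=> cr /coordsP hu /coordsP hw; apply/ffunP => C; rewrite !ffunE.
apply: big1 => X sX; case: (boolP (X \in S1)) => X1; last by rewrite hu // mulr0 mul0r.
rewrite hw ?mulr0 //; apply/negP => X2; have := cr _ _ X1 X2.
by rewrite (_ : _ :&: _ = set0) ?eqxx //; apply/setP => z; rewrite !inE; case: (z \in X).
Qed.

End Leads.

(** * Changes of generators outside V *)

Section Moves.
Variables (T : finType) (K : fieldType) (V : {set T}).
Notation chainK := (chain T K).
Implicit Types (A B C : {set T}) (S : {set {set T}}) (u w : chainK) (Y : {vspace chain T K}).

Definition sized b : {set {set T}} := [set B : {set T} | #|B| == b].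

(** What is remembered of an automorphism fixing the generators in V: contraction by the generator x
    after the change corresponds to contraction by the functional [ls x] before it. *)
Record good (Th : 'End(chain T K)) (ls : T -> T -> K) : Prop := Good {
  good_inj : lker Th = 0%VS;
  good_ctr : forall x u, ctr x (Th u) = Th (ct (ls x) u);
  good_ctrV : forall v u, v \in V -> ctr v (Th u) = Th (ctr v u);
  good_epsV : forall v u, v \in V -> eps v (Th u) = Th (eps v u);
  good_size : forall b u, carried (sized b) u -> carried (sized b) (Th u);
  good_set0 : forall u, Th u set0 = u set0 }.

Lemma good_id : good \1%VF (fun x y => (x == y)%:R).
Proof.
split=> //.
- by apply/eqP/lker0P => u w; rewrite !lfunE.
- move=> x u; rewrite !lfunE /= /ct (bigD1 x) //= eqxx scale1r big1 ?addr0 //.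
  by move=> y /negbTE yx; rewrite eq_sym yx scale0r.
- by move=> v u _; rewrite !lfunE.
- by move=> v u _; rewrite !lfunE.
- by move=> b u hu; rewrite lfunE.
- by move=> u; rewrite lfunE.
Qed.

Definition moveL j z (t : K) : 'End(chain T K) := linfun (@move T K j z t).

Lemma moveLE j z t u : moveL j z t u = u + t *: eps j (ctr z u).
Proof. by rewrite lfunE. Qed.

Lemma moveK j z t u : j != z -> moveL j z (- t) (moveL j z t u) = u.
Proof.
move=> jz; have e0 : ctr z (eps j (ctr z u)) = 0.
  by rewrite ctr_eps eq_sym (negbTE jz) scale0r sub0r ctr_sqr linear0 oppr0.
by rewrite !moveLE [ctr z (_ + _)]linearD linearZ /= e0 scaler0 addr0 scaleNr addrK.
Qed.

Lemma moveL_inj j z t : j != z -> lker (moveL j z t) = 0%VS.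
Proof. by move=> jz; apply/eqP/lker0P; apply: can_inj (moveK t^~ jz). Qed.

Lemma carried_sized_move j z t b u : carried (sized b) u -> carried (sized b) (moveL j z t u).
Proof.
move=> hu B hB; rewrite moveLE ffunE chainZE hu // add0r !ffunE.
case: ifPn => jB; rewrite ?mulr0 //; case: ifPn => zB; rewrite ?mulr0 //.
rewrite hu ?mulr0 //; apply: contra hB; rewrite !inE cardsU1 zB add1n => /eqP <-.
by rewrite (cardsD1 j) jB.
Qed.

Lemma good_move Th ls j z t : j \notin V -> z \notin V -> j != z -> good Th ls ->
  good (moveL j z t \o Th)%VF (fun x y => ls x y + (x == j)%:R * t * ls z y).
Proof.
move=> jV zV jz gTh; split.
- apply/eqP/lker0P => u w; rewrite !comp_lfunE => e.
  have /eqP/lker0P hT := good_inj gTh; apply: hT.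
  by rewrite -(moveK t (Th u) jz) e moveK.
- move=> x u; rewrite !comp_lfunE.
  have -> : ct (fun y => ls x y + (x == j)%:R * t * ls z y) u =
     ct (ls x) u + ((x == j)%:R * t) *: ct (ls z) u.
    rewrite /ct scaler_sumr -big_split; apply: eq_bigr => y _ /=.
    by rewrite scalerA -scalerDl.
  rewrite [Th (_ + _)]linearD linearZ /= -!(good_ctr gTh); set w := Th u.
  have e1 c : ctr z (ctr x w + c *: ctr z w) = - ctr x (ctr z w).
    by rewrite linearD linearZ /= ctr_sqr scaler0 addr0 ctr_ctr.
  rewrite !moveLE e1 linearN scalerN [ctr x (_ + _)]linearD linearZ /= ctr_eps.
  by rewrite scalerBr scalerA mulrC addrA.
- move=> v u vV; rewrite !comp_lfunE -(good_ctrV gTh) //; set w := Th u.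
  rewrite !moveLE linearD linearZ /= ctr_eps (_ : v == j = false) ?scale0r ?sub0r; last first.
    by apply: contraNF jV => /eqP <-.
  by rewrite [ctr z (ctr v w)]ctr_ctr [eps j (- _)]linearN.
- move=> v u vV; rewrite !comp_lfunE -(good_epsV gTh) //; set w := Th u.
  rewrite !moveLE linearD linearZ /= ctr_eps (_ : z == v = false) ?scale0r ?sub0r; last first.
    by apply: contraNF zV => /eqP ->.
  by rewrite [eps j (- _)]linearN [eps v (eps j _)]eps_eps.
- by move=> b u hu; rewrite comp_lfunE; apply/carried_sized_move/(good_size gTh).
- move=> u; rewrite comp_lfunE moveLE ffunE chainZE [eps _ _ _]ffunE inE mulr0 addr0.
  exact: (good_set0 gTh).
Qed.

End Moves.

(** * Maximising the leading monomials *)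

Section Stable.
Variables (T : finType) (n : nat) (idx : T -> nat).
Hypothesis idx_inj : injective idx.
Hypothesis idx_lt : forall x, (idx x < n)%N.
Variable K : fieldType.
Hypothesis nonroot : forall P : {poly K}, P != 0 -> exists t, P.[t] != 0.
Variables (V : {set T}) (r : nat) (L : {set {set T}}).
Hypothesis V_first : forall j z, (idx j < idx z)%N -> z \in V -> j \in V.
Notation chainK := (chain T K).
Notation leads := (@leads T n idx K).
Notation good := (@good T K V).
Variable Q : {set {set T}}.
Hypothesis Q_exchange : forall (B : {set T}) j x, j \in V -> j \in B -> x \notin B :\ j ->
  x |: (B :\ j) \in Q -> B \in Q.
Implicit Types (Th : 'End(chain T K)) (ls : T -> T -> K) (Y : {vspace chain T K}).

(* Moves with [j] in [V] preserve the image of [coords K Q], hence they need not be applied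
   to [Th]. *)
Record state Th ls Y1 Y2 (d1 d2 : nat) : Prop := State {
  st_good : good Th ls;
  st_sub1 : (Y1 <= Th @: coords K Q)%VS;
  st_sub2 : (Y2 <= Th @: coords K Q)%VS;
  st_dim1 : \dim Y1 = d1;
  st_dim2 : \dim Y2 = d2;
  st_wedge : forall u w, u \in Y1 -> w \in Y2 -> wedge u w = 0 }.

Definition line Th X : {vspace chain T K} := <[Th (evec K X)]>%VS.

(** The sum over L concerns single faces: once no move improves it, the generators are generic for
    every face of L, as Koszul exactness requires. *)
Definition potential Th Y1 Y2 : nat :=
  (total_weight n idx (leads Y1) + total_weight n idx (leads Y2) + \sum_(X in L) total_weight n idx (leads (line Th X)))%N.

Definition shifted_all S := forall j z, (idx j < idx z)%N -> shift_closed j z S.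

Definition shifted_off S := forall j z, j \notin V -> (idx j < idx z)%N -> shift_closed j z S.

(** Pulled back along [Th], the added term contracts and then multiplies by j: it replaces a vertex
    by j, and [Q_exchange] is closure under such replacements. *)
Lemma moveL_coords Th ls j z t : good Th ls -> j \in V ->
  (moveL j z t @: (Th @: coords K Q) <= Th @: coords K Q)%VS.
Proof.
move=> gTh jV; apply/subvP => _ /memv_imgP[_ /memv_imgP[u /coordsP hu ->] ->].
rewrite moveLE (good_ctr gTh) (good_epsV gTh) // -linearZ -linearD; apply: memv_img.
apply/coordsP; apply: carriedD => // B hB; rewrite chainZE ffunE.
case: ifPn => jB; rewrite ?mulr0 // ctE big1 ?mulr0 // => x; rewrite inE => xB.
by rewrite hu ?mulr0 //; apply: contra hB; apply: Q_exchange.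
Qed.

Lemma dim_moveL j z t Y : j != z -> \dim (moveL j z t @: Y) = \dim Y.
Proof. by move=> jz; apply: limg_dim_eq; rewrite moveL_inj // capv0. Qed.

Lemma moveL_wedge j z t Y1 Y2 :
  (forall u w, u \in Y1 -> w \in Y2 -> wedge u w = 0) ->
  forall u w, u \in (moveL j z t @: Y1)%VS -> w \in (moveL j z t @: Y2)%VS -> wedge u w = 0.
Proof.
move=> h _ _ /memv_imgP[u uY ->] /memv_imgP[w wY ->].
by rewrite !lfunE /= wedge_move h // linear0.
Qed.

Lemma total_weight_max S : (total_weight n idx S <= \sum_(A : {set T}) wt n idx A)%N.
Proof.
rewrite /total_weight [X in (_ <= X)%N](bigID (mem S)) /=; exact: leq_addr.
Qed.

Lemma potential_max Th Y1 Y2 :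
  (potential Th Y1 Y2 <= (2 + #|L|) * \sum_(A : {set T}) wt n idx A)%N.
Proof.
rewrite mulnDl mul2n -addnn; apply: leq_add; first by apply: leq_add; apply: total_weight_max.
by rewrite -sum_nat_const; apply: leq_sum => X _; apply: total_weight_max.
Qed.

Definition stable Th Y1 Y2 := [/\ shifted_all (leads Y1), shifted_all (leads Y2) &
  forall X, X \in L -> shifted_off (leads (line Th X))].

Lemma exists_stable Th ls Y1 Y2 d1 d2 : state Th ls Y1 Y2 d1 d2 ->
  exists Th' ls' Y1' Y2', state Th' ls' Y1' Y2' d1 d2 /\ stable Th' Y1' Y2'.
Proof.
pose W := ((2 + #|L|) * \sum_(A : {set T}) wt n idx A)%N.
have [m] := ubnP (W - potential Th Y1 Y2); elim: m Th ls Y1 Y2 => // m IH Th ls Y1 Y2 hm st.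
have again Th' ls' Y1' Y2' : state Th' ls' Y1' Y2' d1 d2 -> (potential Th Y1 Y2 < potential Th' Y1' Y2')%N ->
    exists Th' ls' Y1' Y2', state Th' ls' Y1' Y2' d1 d2 /\ stable Th' Y1' Y2'.
  move=> st' lt; apply: IH st'; have := potential_max Th' Y1' Y2'; rewrite -/W; lia.
pose bad12 j z := ~~ shift_closed j z (leads Y1) || ~~ shift_closed j z (leads Y2).
pose badL j z := [exists X in L, ~~ shift_closed j z (leads (line Th X))].
case: (pickP [pred p : T * T | (idx p.1 < idx p.2)%N &&
    (bad12 p.1 p.2 || ((p.1 \notin V) && badL p.1 p.2))]) => [[j z] /= /andP[jz bad]|ok]; last first.
  exists Th, ls, Y1, Y2; split=> //; split.
  - by move=> j z jz; apply: contraFT (ok (j, z)) => h /=; rewrite jz /bad12 h.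
  - by move=> j z jz; apply: contraFT (ok (j, z)) => h /=; rewrite jz /bad12 h orbT.
  - move=> X XL j z jV jz; apply: contraFT (ok (j, z)) => h /=; rewrite jz jV.
    by rewrite (_ : badL j z) ?orbT //; apply/existsP; exists X; rewrite XL.
have jnz : j != z by apply: contraTneq jz => ->; rewrite ltnn.
have [P1 P10 h1] := move_improves idx_inj idx_lt Y1 jz.
have [P2 P20 h2] := move_improves idx_inj idx_lt Y2 jz.
have /fin_all_exists2[P P0 hP] X := move_improves idx_inj idx_lt (line Th X) jz.
(* One t serves both families and all lines, as it avoids the roots of a single product. *)
have [t] : exists t, (P1 * P2 * \prod_X P X).[t] != 0.
  apply: nonroot; rewrite !mulf_neq0 //; apply/prodf_neq0 => X _; exact: P0.
rewrite !hornerM !mulf_eq0 !negb_or => /andP[/andP[P1t P2t] Pt].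
have {Pt} PXt X : (P X).[t] != 0.
  by apply: contraNneq Pt => h0; rewrite horner_prod (bigD1 X) //= h0 mul0r.
have [le1 lt1] := h1 t P1t; have [le2 lt2] := h2 t P2t.
have leX X := hP X t (PXt X).
pose Y1' := (moveL j z t @: Y1)%VS; pose Y2' := (moveL j z t @: Y2)%VS.
have sub Y Z : (Y <= Z)%VS -> (moveL j z t @: Y <= moveL j z t @: Z)%VS by apply: limgS.
case: (boolP (j \in V)) => jV.
  apply: (again Th ls Y1' Y2').
    split; rewrite ?dim_moveL //; try by case: st.
    - apply: subv_trans (moveL_coords _ _ (st_good st) jV); exact/sub/(st_sub1 st).
    - apply: subv_trans (moveL_coords _ _ (st_good st) jV); exact/sub/(st_sub2 st).
    - apply: moveL_wedge; exact: st_wedge st.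
  rewrite /potential ltn_add2r; move: bad; rewrite jV /= orbF => /orP[/lt1|/lt2] lt.
    by rewrite -addSn leq_add.
  by rewrite -addnS leq_add.
have zV : z \notin V by apply: contra jV; apply: V_first.
have eX X : line (moveL j z t \o Th)%VF X = (linfun (move j z t) @: line Th X)%VS.
  by rewrite /line limg_line comp_lfunE.
have gTh := good_move t jV zV jnz (st_good st).
apply: (again _ _ Y1' Y2').
  split; rewrite ?dim_moveL //; try by case: st.
  - exact: gTh.
  - by rewrite limg_comp; apply/sub/(st_sub1 st).
  - by rewrite limg_comp; apply/sub/(st_sub2 st).
  - apply: moveL_wedge; exact: st_wedge st.
have leL : (\sum_(X in L) total_weight n idx (leads (line Th X)) <=
    \sum_(X in L) total_weight n idx (leads (line (moveL j z t \o Th)%VF X)))%N.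
  by apply: leq_sum => X _; rewrite eX; have [] := leX X.
case/orP: bad => [/orP[/lt1|/lt2] lt|/andP[_ /existsP[X /andP[XL hX]]]].
- by rewrite /potential -!addSn !leq_add.
- by rewrite /potential -addSn -addnS !leq_add.
rewrite /potential -addnS !leq_add // (bigD1 X) //= [X in (_ < X)%N](bigD1 X) //= -addSn.
apply: leq_add; first by rewrite eX; have [_] := leX X; apply.
by apply: leq_sum => X' _; rewrite eX; have [] := leX X'.
Qed.

End Stable.

(** * Leading monomials of the complex *)

Section Depth.
Variables (F K : fieldType) (iota : {rmorphism F -> K}).
Variables (T : finType) (n : nat) (idx : T -> nat).
Hypothesis idx_inj : injective idx.
Hypothesis idx_lt : forall x, (idx x < n)%N.
Hypothesis card_pre : forall k, (k <= n)%N -> #|pre idx k| = k.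
Variable el : nat -> T.
Hypothesis elK : forall k, (k < n)%N -> idx (el k) = k.
Variables (r rho : nat) (L : {set {set T}}).
Notation V := (pre idx r).
Hypothesis cL : closed_complex L.
Hypothesis L0 : set0 \in L.
Hypothesis LV : forall X, X \in L -> [disjoint X & V].
Hypothesis vL : forall m b, (b + m <= rho)%N -> vanish_links F L m b.
Hypothesis rrho : (r <= rho)%N.
Hypothesis rn : (r <= n)%N.
Notation chainK := (chain T K).
Notation lead := (@lead T n idx K).
Notation leads := (@leads T n idx K).
Variables (Th : 'End(chain T K)) (ls : T -> T -> K).
Hypothesis gTh : good V Th ls.
Hypothesis line_shift : forall X, X \in L -> shifted_off idx V (leads (line Th X)).
Implicit Types (A B C X : {set T}) (D : {set {set T}}) (u w : chainK).

Let leadsE := leadsP idx_inj idx_lt.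

Definition join_V : {set {set T}} := [set A : {set T} | A :\: V \in L].

Lemma join_closed : closed_complex join_V.
Proof. by move=> A B; rewrite !inE => AJ sBA; apply: cL AJ _; apply: setSD. Qed.

Lemma L_sub_join : L \subset join_V.
Proof. by apply/subsetP => X XL; rewrite inE (setDidPl (LV XL)). Qed.

Definition init D b := leads (Th @: coords K (faces D b)).

Lemma initP D b A :
  reflect (exists2 u, carried (faces D b) u & lead (Th u) A) (A \in init D b).
Proof.
apply: (iffP (leadsE _ _)) => [[_ /memv_imgP[u /coordsP hu ->] h]|[u hu h]]; first by exists u.
by exists (Th u) => //; apply: memv_img; apply/coordsP.
Qed.

Lemma init_sub D D' b : D \subset D' -> init D b \subset init D' b.
Proof.
move=> sD; apply/subsetP => A /initP[u hu h]; apply/initP; exists u => //.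
by apply: carriedS hu; apply/subsetP => B /facesP[BD <-]; apply/facesP; rewrite (subsetP sD).
Qed.

Lemma init_card D b A : A \in init D b -> #|A| = b.
Proof.
case/initP => u hu [uA _].
have /(good_size gTh) h : carried (sized T b) u.
  by apply: carriedS hu; apply/subsetP => B /facesP[_ <-]; rewrite inE.
by apply/eqP; apply: contraNT uA => hA; rewrite h // inE.
Qed.

Lemma card_init D b : #|init D b| = #|faces D b|.
Proof.
by rewrite card_leads // limg_dim_eq ?(dim_coords idx_inj idx_lt) // (good_inj gTh) capv0.
Qed.

Lemma carried_ct D b l u : closed_complex D -> carried (faces D b.+1) u ->
  carried (faces D b) (ct l u).
Proof.
move=> cD hu B hB; rewrite ctE big1 // => x; rewrite inE => xB.
rewrite hu ?mulr0 //; apply: contra hB => /facesP[h1 /eqP h2]; apply/facesP; split.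
  by apply: cD h1 _; apply: subsetUr.
by move: h2; rewrite cardsU1 xB eqSS => /eqP.
Qed.

Lemma init_D1 D b A a : closed_complex D -> A \in init D b.+1 -> a \in A ->
  A :\ a \in init D b.
Proof.
move=> cD /initP[u hu h] aA; apply/initP; exists (ct (ls a) u); first exact: carried_ct.
by rewrite -(good_ctr gTh); apply: lead_ctr.
Qed.

Lemma init_subset D b A B : closed_complex D -> A \in init D b -> B \subset A ->
  B \in init D #|B|.
Proof.
move=> cD; have [m] := ubnP b; elim: m b A => // m IH b A hm hA sBA.
case: (eqVneq B A) => [->|BA]; first by rewrite (init_card hA).
have [a aA aB] : exists2 a, a \in A & a \notin B.
  by apply/subsetPn; apply: contra BA => sAB; rewrite eqEsubset sBA.
have cA := init_card hA; case: b hm hA cA => [|b] hm hA cA.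
  by move: aA; rewrite (cards0_eq cA) inE.
apply: (IH b (A :\ a)) => //; last by rewrite subsetD1 sBA.
exact: init_D1 hA aA.
Qed.

Lemma init_addV b A v : v \in V -> v \notin A -> A \in init join_V b ->
  v |: A \in init join_V b.+1.
Proof.
move=> vV vA /initP[u hu h]; apply/initP; exists (eps v u); last first.
  by rewrite -(good_epsV gTh) //; apply: lead_eps.
move=> B hB; rewrite ffunE; case: ifPn => // vB; rewrite hu ?mulr0 //.
apply: contra hB => /facesP[]; rewrite inE => h1 h2; apply/facesP; split; last first.
  by rewrite (cardsD1 v) vB h2.
rewrite inE; suff -> : B :\: V = B :\ v :\: V by [].
by rewrite setDDl [[set v] :|: V](setUidPr _) // sub1set.
Qed.

Lemma init_addVs b A X : X \subset V -> A \in init join_V b ->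
  X :|: A \in init join_V #|X :|: A|.
Proof.
have [m] := ubnP #|X :\: A|; elim: m b A => // m IH b A hm sX hA.
case: (set_0Vmem (X :\: A)) => [/eqP|[v]].
  by rewrite setD_eq0 => /setUidPr ->; rewrite (init_card hA).
rewrite inE => /andP[vA vX].
have e : X :|: A = X :|: (v |: A) by rewrite setUCA setUA (setUidPr (_ : [set v] \subset X)) // sub1set.
rewrite e; apply: (IH b.+1) => //; last by apply: init_addV => //; apply: (subsetP sX).
apply: leq_trans (hm : _ <= m)%N; apply: proper_card; apply/properP; split.
  by apply: setDS; apply: subsetUr.
by exists v; rewrite !inE ?vA // eqxx.
Qed.

Lemma ctr0_avoid v u B : ctr v u = 0 -> v \in B -> u B = 0.
Proof.
move=> /ffunP/(_ (B :\ v)); rewrite !ffunE !inE eqxx /= => /eqP + vB.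
by rewrite setD1K // mulf_eq0 /sg signr_eq0 => /eqP.
Qed.

Lemma avoid_ctr0 v u : (forall B, v \in B -> u B = 0) -> ctr v u = 0.
Proof.
by move=> h; apply/ffunP => B; rewrite !ffunE h ?setU11 // mulr0 if_same.
Qed.

Lemma good_inj_eq u w : Th u = Th w -> u = w.
Proof. by have /eqP/lker0P := good_inj gTh; apply. Qed.

Definition block p : {set T} := pre idx (r + p)%N :\: V.

Definition ctrs p (f : nat -> T) u := iteri p (fun i w => ctr (f i) w) u.

Lemma ctrsS p f u : ctrs p.+1 f u = ctrs p (fun i => f i.+1) (ctr (f 0%N) u).
Proof. by rewrite /ctrs; elim: p => //= p ->. Qed.

Lemma Th_ctn p f u : Th (ctn p (fun i => ls (f i)) u) = ctrs p f (Th u).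
Proof.
elim: p f u => // p IH f u; rewrite ctrsS /= (IH (fun i => f i.+1)).
by rewrite -(good_ctr gTh).
Qed.

Lemma ctrs_neq0 p f u B :
  (forall i j, (i < p)%N -> (j < p)%N -> f i = f j -> i = j) ->
  (forall i, (i < p)%N -> f i \notin B) ->
  (ctrs p f u B == 0) = (u ([set f (val i) | i : 'I_p] :|: B) == 0).
Proof.
elim: p f u => [|p IH] f u fI hB.
  by rewrite (_ : [set _ | _ in _] = set0) ?set0U //; apply/setP => x; rewrite inE; apply/imsetP => -[[]].
rewrite ctrsS IH; last 2 first.
- by move=> i j ip jp /fI e; apply: succn_inj; apply: e.
- by move=> i ip; apply: hB.
rewrite ffunE ifN; last first.
  rewrite inE negb_or hB // andbT; by apply/negP => /imsetP[i _ /fI e]; have := e isT (ltn_ord i).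
rewrite mulf_eq0 /sg signr_eq0 /= setUA; congr (u (_ :|: B) == 0).
apply/setP => x; rewrite !inE; apply/orP/imsetP => [[/eqP->|/imsetP[i _ ->]]|[[[|i] ip] _ ->]].
- by exists ord0.
- by exists (lift ord0 i).
- by left.
- by right; apply/imsetP; exists (Ordinal (ip : (i < p)%N)).
Qed.

Lemma card_block p : (r + p <= n)%N -> #|block p| = p.
Proof.
move=> h; rewrite cardsD (setIidPr _) ?card_pre // ?addKn //.
by apply/subsetP => x; rewrite !inE => /leq_trans; apply; apply: leq_addr.
Qed.

Lemma sizeL X : X \in L -> (r + #|X| <= n)%N.
Proof.
move=> /LV dXV; have -> : (r + #|X| = #|V :|: X|)%N.
  rewrite cardsU (_ : V :&: X = set0) ?cards0 ?subn0 ?card_pre //.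
  by apply/eqP; rewrite setI_eq0 disjoint_sym.
rewrite -[X in (_ <= X)%N](card_pre (leqnn n)); apply: subset_leq_card.
by apply/subsetP => x _; rewrite inE.
Qed.

(* The only lead of the line spanned by the monomial of [X] is shifted, so it is an initial
   segment outside [V]: this is the genericity required by [nondeg]. *)
Lemma line_lead X : X \in L -> Th (evec K X) (block #|X|) != 0.
Proof.
move=> XL; set u := Th (evec K X).
have hX : carried (faces L #|X|) (evec K X).
  move=> B hB; rewrite evecE; case: eqP hB => // -> /facesP. by case.
have u0 : u != 0.
  have e0 : Th 0 = 0 by apply: linear0.
  apply/eqP; rewrite -e0 => /good_inj_eq /ffunP/(_ X)/eqP; rewrite evecE eqxx ffunE.
  by rewrite oner_eq0.
have c1 : #|leads (line Th X)| = 1%N by rewrite card_leads // dim_vline u0.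
have /card_gt0P[A AI] : (0 < #|leads (line Th X)|)%N by rewrite c1.
have cA : #|A| = #|X|.
  apply: (@init_card L); apply/initP; have /leadsE[_ /vlineP[c ->] hl] := AI.
  exists (c *: evec K X); first by move=> B hB; rewrite chainZE hX // mulr0.
  by rewrite linearZ.
have uA : u A != 0.
  have /leadsE[_ /vlineP[c ->] [+ _]] := AI.
  by rewrite chainZE mulf_eq0 negb_or => /andP[].
have AV : [disjoint A & V].
  rewrite -setI_eq0; apply/eqP/setP => v; rewrite inE [RHS]inE; apply/negP => /andP[vA vV].
  have : ctr v u = 0.
    rewrite /u (good_ctrV gTh) // avoid_ctr0 ?linear0 // => B vB; rewrite evecE.
    case: eqP => // e; have := LV XL; rewrite -e => /disjointFr/(_ vB).
    by rewrite vV.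
  by move=> /ctr0_avoid/(_ vA)/eqP; rewrite (negbTE uA).
suff -> : block #|X| = A by [].
have sh := line_shift XL.
have cB : #|block #|X| | = #|X| by rewrite card_block ?sizeL.
apply/eqP; rewrite eq_sym eqEcard cA cB leqnn andbT; apply: contraT => /subsetPn[z zA zB].
have [j jB jA] : exists2 j, j \in block #|X| & j \notin A.
  apply/subsetPn; apply: contra zB => sBA.
  suff -> : block #|X| = A by [].
  by apply/eqP; rewrite eqEcard sBA cA cB leqnn.
have zV : z \notin V by rewrite (disjointFr AV zA).
have jV : j \notin V by move: jB; rewrite inE => /andP[].
have jz : (idx j < idx z)%N.
  move: jB zB zV; rewrite !inE => /andP[_ jX]; rewrite negb_and negbK => /orP[->//|].
  by rewrite -leqNgt => Xz _; apply: leq_trans Xz.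
have hA' := shift_closedP _ _ _ (sh j z jV jz) A AI zA jA.
have := subset_leq_card (_ : [set A; swap j z A] \subset leads (line Th X)).
rewrite c1 cards2 (_ : A != swap j z A); last first.
  by apply: contraNneq jA => ->; rewrite setU11.
by apply; apply/subsetP => B /set2P[]->.
Qed.

(** The determinant asked for by [nondeg_ctn] is, up to sign, the coordinate of [Th (evec K X)] at
    the first [#|X|] elements after V. *)
Lemma nondegL m : (r + m <= n)%N -> nondeg m L (fun i => ls (el (r + i)%N)).
Proof.
move=> hm; apply: nondeg_ctn => // X XL Xm.
rewrite -(good_set0 gTh) Th_ctn ctrs_neq0.
- rewrite setU0 (_ : [set _ | _ in _] = block #|X|); first exact: line_lead.
  apply/setP => x; apply/imsetP/idP => [[i _ ->]|].
    have h : (r + i < n)%N by apply: leq_trans hm; rewrite ltn_add2l (leq_trans (ltn_ord i)).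
    by rewrite /= !inE elK // -leqNgt leq_addr ltn_add2l /=.
  rewrite !inE -leqNgt => /andP[rx xr].
  have ip : (idx x - r < #|X|)%N by rewrite ltn_subLR.
  exists (Ordinal ip) => //=; apply: idx_inj; rewrite subnKC // elK //.
- move=> i j iX jX e; have {}e := congr1 idx e; move: e.
  have lt k : (k < #|X|)%N -> (r + k < n)%N.
    by move=> kX; apply: leq_trans hm; rewrite ltn_add2l (leq_trans kX).
  by rewrite !elK ?lt // => /addnI.
- by move=> i _; rewrite inE.
Qed.

(** Elements are added from the last one down. In the step for m + 1, C avoids the first r + m + 1
    elements, hence so do all monomials of [Th u], and u is killed by m + 1 functionals. A primitive
    of u for the last of them that the others kill has leading monomial C with the last element
    added. *)
Lemma init_block m b C : (b + m <= rho)%N -> (r + m <= n)%N ->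
  C \in init L b -> [disjoint C & pre idx (r + m)%N] -> block m :|: C \in init L (b + m)%N.
Proof.
elim: m b C => [|m IH] b C bm rm hC dC.
  by rewrite /block !addn0 setDv set0U.
pose x := el (r + m)%N; have xn : (r + m < n)%N by rewrite -addnS.
have ix : idx x = (r + m)%N by apply: elK.
have xC : x \notin C.
  by apply: contraTN dC => xC; apply/pred0Pn; exists x; rewrite /= xC inE ix addnS ltnSn.
have /initP[u hu [uC leadu]] := hC.
have avoidu i B : (i <= m)%N -> el (r + i)%N \in B -> Th u B = 0.
  move=> im iB; apply/eqP; apply: contraT => /leadu; rewrite leqNgt => /negP[].
  apply: (wt_lt idx_inj idx_lt iB) => z zC; rewrite elK; last by apply: leq_trans xn; rewrite ltnS leq_add2l.
  have := disjointFr dC zC; rewrite inE => /negbT; rewrite -leqNgt addnS; apply: leq_trans.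
  by rewrite ltnS leq_add2l.
have ker_u i : (i < m.+1)%N -> ct (ls (el (r + i)%N)) u = 0.
  move=> im; apply: good_inj_eq; rewrite -(good_ctr gTh) linear0.
  by apply: avoid_ctr0 => B; apply: avoidu.
have [w [hw wm wi]] := kill_exact iota cL L0 (nondegL rm) (vL bm) hu ker_u (ltnSn m).
have xw : ctr x (Th w) = Th u by rewrite (good_ctr gTh) wm.
(* Earlier elements do not occur in [Th w]: those of V because w lives on L, the others because
   their functionals kill w. *)
have avoidw z B : (idx z < r + m)%N -> z \in B -> Th w B = 0.
  move=> zm zB; apply: (ctr0_avoid _ zB); case: (ltnP (idx z) r) => zr.
    have zV : z \in V by rewrite inE.
    rewrite (good_ctrV gTh) // avoid_ctr0 ?linear0 // => B' zB'; apply: hw.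
    by apply/negP => /facesP[/LV/disjointFr/(_ zB')]; rewrite zV.
  have zi : (idx z - r < m)%N by rewrite ltn_subLR.
  have <- : el (r + (idx z - r))%N = z.
    by apply: idx_inj; rewrite subnKC // elK.
  by rewrite (good_ctr gTh) wi ?linear0 // ?ltnS ?(ltnW zi) // neq_ltn zi.
have TuE B : Th u B = if x \in B then 0 else sg K B x * Th w (x |: B) by rewrite -xw ffunE.
have hxC : x |: C \in init L b.+1.
  apply/initP; exists w => //; split.
    by apply: contraNneq uC => h; rewrite TuE (negbTE xC) h mulr0.
  move=> B wB; case: (boolP (x \in B)) => xB.
    rewrite (wtD1 n idx xB) wtU1 // leq_add2l; apply: leadu.
    by rewrite TuE !inE eqxx /= setD1K // mulf_neq0 // /sg signr_eq0.
  apply: ltnW; apply: (wt_lt idx_inj idx_lt (setU11 x C)) => z zB.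
  rewrite ix ltn_neqAle leqNgt; apply/andP; split; last first.
    by apply: contra wB => zm; rewrite (avoidw z B zm zB).
  by rewrite -ix (inj_eq idx_inj); apply: contraNneq xB => ->.
have -> : block m.+1 :|: C = block m :|: (x |: C).
  apply/setP => y; rewrite !inE addnS ltnS [(idx y <= _)%N]leq_eqVlt -ix (inj_eq idx_inj).
  case: (eqVneq y x) => [->|] /=; last by [].
  by rewrite ix -leqNgt leq_addr orbT.
rewrite addnS -addSn; apply: IH => //; [by rewrite addSnnS | exact: ltnW |].
rewrite -setI_eq0 setIUl setU_eq0; apply/andP; split; rewrite setI_eq0.
  by rewrite disjoints1 inE ix ltnn.
by apply: disjointWr dC; apply/subsetP => y; rewrite !inE addnS ltnS; apply: ltnW.
Qed.

(** The reflection lies in [pre l] together with the part B of A beyond the last zero l, so it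
    suffices to enlarge B by the whole prefix: by V because of the join, by the elements between V
    and l through [init_block]. *)
Lemma init_flip A : (r.*2 <= n)%N -> A \in init join_V r -> flip n idx A \in init join_V r.
Proof.
move=> rn2 hA; have cA := init_card hA.
set l := lastk n idx A.
have [l1 l2] := lastkP n idx A; rewrite -/l in l1 l2.
pose B := A :\: pre idx l.
have hB : B \in init join_V #|B| by apply: init_subset join_closed hA (subsetDl _ _).
suff full : pre idx l :|: B \in init join_V #|pre idx l :|: B|.
  rewrite -(card_flip idx_lt card_pre A) in cA.
  rewrite -cA; apply: (init_subset join_closed full).
  by rewrite /flip -/l setSU // subsetDl.
case: (leqP l r) => lr.
  apply: init_addVs hB; apply/subsetP => x; rewrite !inE => xl; exact: leq_trans xl lr.
have BV : [disjoint B & V].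
  rewrite -setI_eq0; apply/eqP/setP => x; rewrite !inE; apply/negbTE/negP.
  by move=> /andP[/andP[h _] xr]; rewrite (ltn_trans xr lr) in h.
(* B avoids V, hence so does every monomial of [Th u]; contracting by the elements of V shows that u
   itself lives on L. *)
have hBL : B \in init L #|B|.
  have /initP[u hu [uB leadu]] := hB; apply/initP; exists u => // C hC.
  case: (boolP (C \in faces join_V #|B|)) => [/facesP[CJ cC]|/hu //].
  have [v vC vV] : exists2 v, v \in C & v \in V.
    apply/exists_inP; apply: contraR hC => /exists_inPn h; apply/facesP; split=> //.
    move: CJ; rewrite inE (setDidPl _) //; apply/pred0P => x /=.
    by apply/negbTE/negP => /andP[xC xV]; have := h x xC; rewrite xV.
  apply: (ctr0_avoid _ vC); apply: good_inj_eq; rewrite -(good_ctrV gTh) // linear0.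
  apply: avoid_ctr0 => X vX; apply/eqP; apply: contraT => /leadu; rewrite leqNgt => /negP[].
  apply: (wt_lt idx_inj idx_lt vX) => z; rewrite !inE -leqNgt => /andP[lz _].
  move: vV; rewrite inE => vr; exact: leq_trans vr (leq_trans (ltnW lr) lz).
have cB : (#|B| + cnt idx A l = r)%N.
  by rewrite -cA /cnt -(cardsID (pre idx l) A) addnC.
have h2 : (r + (l - r) = l)%N by rewrite subnKC // ltnW.
have hC : block (l - r) :|: B \in init L (#|B| + (l - r))%N.
  apply: init_block => //; rewrite ?h2 //.
    (* B has r - l/2 elements, so the size to be reached is l/2, at most r. *)
    by apply: leq_trans rrho; lia.
  by rewrite -setI_eq0; apply/eqP/setP => x; rewrite !inE; case: (_ < l)%N; rewrite ?andbF.
have {}hC := subsetP (init_sub _ L_sub_join) _ hC.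
have := init_addVs (subxx V) hC.
suff -> : V :|: (block (l - r) :|: B) = pre idx l :|: B by [].
rewrite setUA; congr (_ :|: _); apply/setP => x; rewrite !inE h2.
by case: (ltnP (idx x) r) => //= xr; rewrite (ltn_trans xr lr).
Qed.

Lemma init_avoid : (#|faces L r| <= #|[set A in init join_V r | [disjoint A & V]]|)%N.
Proof.
rewrite -card_init; apply: subset_leq_card; apply/subsetP => A hA; rewrite inE.
rewrite (subsetP (init_sub _ L_sub_join) _ hA) /=; have /initP[u hu [uA _]] := hA.
rewrite -setI_eq0; apply/eqP/setP => v; rewrite inE [RHS]inE; apply/negP => /andP[vA vV].
case/eqP: uA; apply: (ctr0_avoid _ vA); rewrite (good_ctrV gTh) // avoid_ctr0 ?linear0 //.
by move=> B vB; apply: hu; apply/negP => /facesP[/LV/disjointFr/(_ vB)]; rewrite vV.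
Qed.

End Depth.

(** * Scalar extension and the bound for uniform families *)

Lemma infinite_extension (F : fieldType) :
  exists (K : fieldType) (i : {rmorphism F -> K}),
    forall P : {poly K}, P != 0 -> exists t, P.[t] != 0.
Proof.
exists {fraction {poly F}}, (@tofrac {poly F} \o polyC : {rmorphism _ -> _}) => P P0.
pose s := [seq tofrac ('X^i : {poly F}) | i <- iota 0 (size P)].
have us : uniq s.
  rewrite map_inj_in_uniq ?iota_uniq // => i j _ _ /eqP; rewrite tofrac_eq => /eqP e.
  by have := size_polyXn F i; rewrite e size_polyXn => -[].
have : ~~ all (root P) s.
  apply/negP => h; have := max_poly_roots P0 h us.
  by rewrite size_map size_iota ltnn.
by case/allPn => t _ h; exists t.
Qed.

Local Close Scope ring_scope.

Section Uniform.
Variables (F K : fieldType) (iota : {rmorphism F -> K}).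
Hypothesis nonroot : forall P : {poly K}, P != 0%R -> exists t, P.[t]%R != 0%R.
Variables (T : finType) (n : nat) (idx : T -> nat).
Hypothesis idx_inj : injective idx.
Hypothesis idx_lt : forall x, idx x < n.
Hypothesis card_pre : forall k, k <= n -> #|pre idx k| = k.
Variable el : nat -> T.
Hypothesis elK : forall k, k < n -> idx (el k) = k.
Variables (r rho : nat) (L : {set {set T}}).
Notation V := (pre idx r).
Hypothesis cL : closed_complex L.
Hypothesis L0 : set0 \in L.
Hypothesis LV : forall X, X \in L -> [disjoint X & V].
Hypothesis vL : forall m b, b + m <= rho -> vanish_links F L m b.
Hypothesis rrho : r <= rho.
Hypothesis rn : r.*2 <= n.
Notation J := (join_V idx r L).

Lemma uniform_bound (S1 S2 : {set {set T}}) :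
  S1 \subset faces J r -> S2 \subset faces J r -> S1 != set0 -> S2 != set0 ->
  cross_intersecting S1 S2 -> #|S1| + #|S2| + #|faces L r| <= #|faces J r| + 1.
Proof.
move=> s1 s2 n1 n2 cr.
have rn1 : r <= n by apply: leq_trans rn; rewrite -addnn leq_addr.
have cJ : closed_complex J by apply: join_closed.
have exch (B : {set T}) j x : j \in V -> j \in B -> x \notin B :\ j ->
    x |: (B :\ j) \in faces J r -> B \in faces J r.
  move=> jV jB xB /facesP[hJ c]; apply/facesP; split.
    have : B :\ j \in J by apply: cJ hJ _; apply: subsetUr.
    by rewrite !inE setDDl [_ :|: V](setUidPr _) ?sub1set.
  by rewrite -c cardsU1 xB (cardsD1 j B) jB.
have Vf j z : idx j < idx z -> z \in V -> j \in V.
  by rewrite !inE => jz; apply: ltn_trans.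
have subQ (S : {set {set T}}) : S \subset faces J r ->
    (coords K S <= \1%VF @: coords K (faces J r))%VS.
  move=> sS; rewrite lim1g; apply/subvP => u /coordsP hu; apply/coordsP.
  exact: carriedS hu.
have st0 : state V (faces J r) \1%VF (fun x y => (x == y)%:R%R) (coords K S1) (coords K S2) #|S1| #|S2|.
  split; rewrite ?(dim_coords idx_inj idx_lt) ?subQ //; first exact: good_id.
  by move=> u w; apply: wedge_coords.
have [Th [ls [Y1 [Y2 [st [h1 h2 hL]]]]]] :=
  exists_stable idx_inj idx_lt nonroot L Vf exch st0.
have gTh := st_good st.
pose Om := init n idx Th J r.
have cI Y : \dim Y = #|leads n idx Y| by rewrite card_leads.
have c1 : #|leads n idx Y1| = #|S1| by rewrite -cI (st_dim1 st).
have c2 : #|leads n idx Y2| = #|S2| by rewrite -cI (st_dim2 st).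
have cOm : #|Om| = #|faces J r| by rewrite (card_init idx_inj idx_lt gTh).
have := init_avoid idx_inj idx_lt LV gTh (r := r); move=> le.
rewrite -c1 -c2 -cOm; apply: leq_trans (_ : _ <= #|leads n idx Y1| + #|leads n idx Y2| +
   #|[set A in Om | [disjoint A & V]]|) _; first by rewrite leq_add2l.
apply: (cross_bound idx_inj idx_lt card_pre rn) => //.
- by move=> A; apply: (init_card idx_inj idx_lt gTh).
- by move=> A; apply: (init_flip iota idx_inj idx_lt card_pre elK cL L0 LV vL rrho rn1 gTh hL).
- exact: leads_sub (st_sub1 st).
- exact: leads_sub (st_sub2 st).
- by rewrite -card_gt0 c1 card_gt0.
- by rewrite -card_gt0 c2 card_gt0.
- move=> A B /(leadsP idx_inj idx_lt)[u uY hu] /(leadsP idx_inj idx_lt)[w wY hw].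
  apply: contraTneq isT => AB; have dAB : [disjoint A & B] by rewrite -setI_eq0 AB.
  by have := lead_wedge idx_inj idx_lt dAB hu hw; rewrite (st_wedge st) // ffunE eqxx.
Qed.

End Uniform.

(** * Ordering the vertices with V first, and the theorem *)

Section Enumeration.
Variables (T : finType) (v : seq T).
Hypothesis uv : uniq v.

Definition enum_from := v ++ [seq x <- enum T | x \notin v].

Lemma enum_from_uniq : uniq enum_from.
Proof.
rewrite cat_uniq uv filter_uniq ?enum_uniq // andbT; apply/hasPn => x.
by rewrite mem_filter => /andP[].
Qed.

Lemma mem_enum_from x : x \in enum_from.
Proof. by rewrite mem_cat mem_filter mem_enum andbT; case: (x \in v). Qed.

Lemma size_enum_from : size enum_from = #|T|.
Proof. by rewrite -(card_uniqP enum_from_uniq); apply: eq_card => x; rewrite mem_enum_from. Qed.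

Lemma card_pre_enum k : k <= #|T| -> #|pre (index^~ enum_from) k| = k.
Proof.
move=> kT; rewrite -[RHS](size_takel (s := enum_from)) ?size_enum_from //.
rewrite -(card_uniqP (take_uniq _ enum_from_uniq)); apply: eq_card => x.
by rewrite inE in_take // mem_enum_from.
Qed.

Lemma pre_enum : pre (index^~ enum_from) (size v) = [set x in v].
Proof.
by apply/setP => x; rewrite !inE -in_take ?mem_enum_from // /enum_from take_size_cat.
Qed.

End Enumeration.

Theorem theorem2p19 (F : fieldType) (T : finType) (D : {set {set T}})
  (d r : nat) (v : seq T) (SA SB : {set {set T}}) :
  simplicial_complex D ->
  depth_is F D d ->
  (2 <= r)%N -> (2 * r <= d)%N ->
  size v = r -> uniq v ->
  SA != set0 -> SB != set0 ->
  SA \subset D -> SB \subset D ->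
  (forall A, A \in SA -> #|A| <= r)%N ->
  (forall B, B \in SB -> #|B| <= r)%N ->
  sperner SA -> sperner SB -> cross_intersecting SA SB ->
  shifted_wrt D v ->
  (#|SA| + #|SB| + #|[set A in D | (#|A| == r) && [disjoint A & [set x in v]]]|
     <= fnum D r + 1)%N.
Proof.
move=> [D0 cD] [dD cm _] r2 rd sv uv nA nB sA sB hA hB spA spB cr sh.
pose G := skel D d; pose V := [set x in v].
have GP A : reflect (A \in D /\ #|A| <= d) (A \in G) by rewrite inE; apply: andP.
have cG : closed_complex G.
  move=> A B /GP[AD Ad] sBA; apply/GP; split; first exact: cD AD sBA.
  exact: leq_trans (subset_leq_card sBA) Ad.
have D_0 : set0 \in D by have [A AD] := set0Pn _ D0; apply: cD AD (sub0set _).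
have mG : maxsize G = d.
  apply/eqP; rewrite eqn_leq; apply/andP; split.
    by apply/bigmax_leqP => A /GP[].
  have [Z ZD cZ] := maxsize_attained D_0.
  have [W /subsetP sW cW] : exists2 W : {set T}, W \subset Z & #|W| = d.
    have : 0 < #|[set W : {set T} | (W \subset Z) & #|W| == d]|.
      by rewrite cards_draws bin_gt0 cZ.
    by case/card_gt0P => W; rewrite inE => /andP[? /eqP ?]; exists W.
  rewrite -cW; apply: maxsize_ge; apply/GP; rewrite cW; split=> //.
  by apply: cD ZD _; apply/subsetP.
have pure A : A \in D -> #|A| <= d -> exists Z, [/\ Z \in D, A \subset Z & #|Z| = d].
  move=> AD Ad; have [|Z [ZG sAZ cZ]] := cm_pure cG cm (X := A); first exact/GP.
  by exists Z; rewrite -mG; split=> //; have [] := GP _ ZG.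
have cV : #|V| = r by rewrite -sv -(card_uniqP uv) cardsE.
have rd1 : r <= d by apply: leq_trans rd; rewrite leq_pmull.
(* The vertices of v are added in order: purity extends the current face by some vertex x, and
   shiftedness exchanges x for the next vertex of v if they differ. *)
have addV X : X \in D -> #|X :|: V| <= d -> X :|: V \in D.
  move=> XD Xd.
  suff H i : i <= size v -> X :|: [set x in take i v] \in D.
    by have := H (size v) (leqnn _); rewrite take_size.
  elim: i => [|i IH] iv; first by rewrite take0 (_ : [set _ in _] = set0) ?setU0 //; apply/setP.
  have {}IH := IH (ltnW iv).
  have x0 : T by case: (v) iv.
  have eT : [set x in take i.+1 v] = nth x0 v i |: [set x in take i v].
    by apply/setP => x; rewrite !inE (take_nth x0) // mem_rcons inE.
  rewrite eT setUCA; set y := nth x0 v i; set B := X :|: _.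
  case: (boolP (y \in B)) => yB; first by rewrite (setUidPr _) // sub1set.
  have sBX : B \subset X :|: V.
    by apply: setUS; apply/subsetP => x; rewrite !inE; apply: mem_take.
  have yXV : y \in X :|: V by rewrite !inE mem_nth // orbT.
  have Bd : #|B| < d.
    by apply: leq_trans Xd; apply: proper_card; apply/properP; split=> //; exists y.
  have [Z [ZD sBZ cZ]] := pure B IH (ltnW Bd).
  have [x xZ xB] : exists2 x, x \in Z & x \notin B.
    by apply/subsetPn; apply: contraL Bd => /subset_leq_card; rewrite cZ -leqNgt.
  have xBD : x |: B \in D by apply: cD ZD _; rewrite subUset sub1set xZ.
  case: (eqVneq x y) => [<- //|xy].
  have := sh i iv (x |: B) x xBD (setU11 _ _).
  rewrite (set_nth_default x0) // -/y setU1K // !inE [y == x]eq_sym (negbTE xy).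
  apply; last by move: yB; rewrite !inE.
  rewrite (take_nth x0) // mem_rcons inE negb_or xy /=.
  by move: xB; rewrite !inE negb_or => /andP[].
have VD : V \in D by have := addV set0 D_0; rewrite set0U cV; apply.
have VG : V \in G by apply/GP; rewrite cV.
pose L := link G V.
have LP (X : {set T}) : reflect [/\ [disjoint V & X], #|X| <= d & V :|: X \in G] (X \in L).
  apply: (iffP (linkP _ _ _)) => [[/GP[_ ?]]|[? ? h]] //; split=> //.
  by apply: cG h (subsetUr _ _).
pose s := enum_from v; pose idx := index^~ s.
have idx_inj : injective idx.
  move=> x y e; transitivity (nth x s (idx x)); first by rewrite nth_index // mem_enum_from.
  by rewrite e nth_index // mem_enum_from.
have idx_lt x : idx x < #|T| by rewrite -(size_enum_from uv) index_mem mem_enum_from.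
have eV : pre idx r = V by rewrite -sv; apply: pre_enum.
have [x0 _] : exists x, x \in V by apply/card_gt0P; rewrite cV; apply: leq_trans r2.
have elK k : k < #|T| -> idx (nth x0 s k) = k.
  by move=> kT; rewrite /idx index_uniq ?(enum_from_uniq uv) ?(size_enum_from uv).
have nT : d <= #|T|.
  by have [Z [_ _ <-]] := pure set0 D_0 (leq_trans (eq_leq (cards0 _)) (leq0n _)); apply: max_card.
(* The link of A in L is a link in the Cohen-Macaulay skeleton; purity gives it a face of size
   [d - r - #|A|], which exceeds b. *)
have vL m b : b + m <= d - r -> vanish_links F L m b.
  move=> bm A AL Am; have [dVA _ VAG] := LP A AL.
  rewrite link_link //; apply: cm => //.
  have cVA : #|V :|: A| = r + #|A|.
    by rewrite cardsU -cV (_ : V :&: A = set0) ?cards0 ?subn0 //; apply/eqP; rewrite setI_eq0.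
  have /GP[VAD VAd] := VAG; have [Z [ZD sZ cZ]] := pure _ VAD VAd.
  apply: (@leq_trans #|Z :\: (V :|: A)|).
    rewrite cardsD (setIidPr sZ) cZ cVA subnDA ltn_subRL; apply: leq_trans bm.
    by rewrite addnC ltn_add2l.
  have ZG : Z \in G by apply/GP; rewrite cZ.
  apply: maxsize_ge; apply/linkP; split.
  - by apply: cG ZG (subsetDl _ _).
  - by rewrite -setI_eq0; apply/eqP/setP => x; rewrite !inE; case: (_ || _).
  - by rewrite -[X in X :|: _](setIidPr sZ) setID.
have L0 : set0 \in L by apply/LP; rewrite setU0 cards0; split=> //; rewrite -setI_eq0 setI0.
have cL : closed_complex L by apply: link_closed.
have LV A : A \in L -> [disjoint A & pre idx r].
  by rewrite eV disjoint_sym => /LP[].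
have rT : r.*2 <= #|T| by apply: leq_trans nT; rewrite -mul2n.
have rrho : r <= d - r by rewrite leq_subRL // addnn -mul2n.
have cAV (A : {set T}) : #|A| = r -> #|A :|: V| <= d.
  move=> cA; apply: leq_trans (leq_trans rd (leqnn d)); rewrite mul2n -addnn.
  by rewrite -{1}cA -cV -cardsUI leq_addr.
have VU (A : {set T}) : V :|: A :\: V = A :|: V.
  by apply/setP => x; rewrite !inE; case: (x \in v); rewrite ?orbT ?orbF.
(* For r-faces, [A :|: V] has at most 2r <= d vertices, which is within the range where V can be
   added. *)
have JE : faces (join_V idx r L) r = faces D r.
  apply/setP => A; apply/facesP/facesP => -[AJ cA]; split=> //.
    move: AJ; rewrite inE eV => /LP[_ _ /GP[h _]]; apply: cD h _.
    by rewrite VU subsetUl.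
  rewrite inE eV; apply/LP; split.
  - by rewrite -setI_eq0; apply/eqP/setP => x; rewrite !inE; case: (x \in v).
  - apply: leq_trans (subset_leq_card (subsetDl _ _)) _; rewrite cA; exact: rd1.
  - by rewrite VU; apply/GP; split; [apply: addV AJ _|]; apply: cAV.
have LE : faces L r = [set A in D | (#|A| == r) && [disjoint A & V]].
  apply/setP => A; rewrite [RHS]inE; apply/facesP/and3P => [[AL cA]|[AD /eqP cA dA]].
    have [dVA _ /GP[VAD _]] := LP A AL; split; rewrite ?cA // 1?disjoint_sym //.
    by apply: cD VAD (subsetUr _ _).
  split=> //; apply/LP; split; rewrite 1?disjoint_sym ?cA //.
  by rewrite setUC; apply/GP; split; [apply: addV AD _|]; apply: cAV.
(* A face of size d containing A supplies [d - #|A|] covers, more than [#|A|] because [#|A| < r] and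
   2r <= d. *)
have up_ge (A : {set T}) : A \in D -> #|A| < r -> #|A| < #|upper_shadow D A|.
  move=> AD Ar; have [Z [ZD sAZ cZ]] := pure A AD (leq_trans (ltnW Ar) rd1).
  apply: (@leq_trans #|(fun x => x |: A) @: (Z :\: A)|).
    rewrite card_in_imset; first rewrite cardsD (setIidPr sAZ) cZ.
      by rewrite ltn_subRL addnn; apply: leq_trans rd; rewrite mul2n ltn_double.
    move=> x y /setDP[_ xA] _ e; have : x \in y |: A by rewrite -e setU11.
    by rewrite inE (negbTE xA) orbF inE => /eqP.
  apply: subset_leq_card; apply/subsetP => _ /imsetP[x /setDP[xZ xA] ->].
  rewrite inE cardsU1 xA eqxx subsetUr !andbT.
  by apply: cD ZD _; rewrite subUset sub1set xZ.
have [SA' [sA' cA' leA upA]] := sperner_push up_ge sA spA hA.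
have [SB' [sB' cB' leB upB]] := sperner_push up_ge sB spB hB.
have [K [iota nonroot]] := infinite_extension F.
rewrite /fnum -/V -LE -[X in _ <= X + 1]/(#|faces D r|) -JE.
apply: leq_trans (_ : #|SA'| + #|SB'| + #|faces L r| <= _); first by rewrite leq_add2r leq_add.
apply: (uniform_bound iota nonroot idx_inj idx_lt (card_pre_enum uv) elK cL L0 LV vL rrho rT).
- by rewrite JE; apply/subsetP => A hA'; apply/facesP; rewrite cA' // (subsetP sA').
- by rewrite JE; apply/subsetP => A hA'; apply/facesP; rewrite cB' // (subsetP sB').
- by rewrite -card_gt0; apply: leq_trans leA; rewrite card_gt0.
- by rewrite -card_gt0; apply: leq_trans leB; rewrite card_gt0.
move=> A B /upA[A0 A0S sA0] /upB[B0 B0S sB0].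
by apply: contraNneq (cr _ _ A0S B0S) => h; rewrite -subset0 -h setISS.
Qed.
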